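(* Let $n\geq 2$. If $\Diamond:\mathcal{K}^n\to\mathcal{K}^n$ is a non-trivial, continuous and $\mathrm{GL}(n)$-covariant operator, then it satisfies a Brunn-Minkowski type inequality for every quermassintegral $W_i$, $i=0,\dots,n-1$; that is, for every $i\in\{0,\dots,n-1\}$ there is a constant $c_{n,i,\Diamond}>0$ (not depending on $K$) such that $$W_i(K)\leq c_{n,i,\Diamond}\,W_i(\Diamond K)\quad\text{for all } K\in\mathcal{K}^n.$$
   Context: $\mathcal{K}^n$ denotes the set of convex bodies (nonempty compact convex sets, not necessarily with interior points) in $\mathbb{R}^n$, with the Hausdorff metric; continuity is with respect to this metric. The operator $\Diamond$ is $\mathrm{GL}(n)$-covariant if $\Diamond(gK)=g\,\Diamond K$ for all $K\in\mathcal{K}^n$ and all $g\in\mathrm{GL}(n)$. It is trivial if $\Diamond K=\{0\}$ for every $K\in\mathcal{K}^n$, and non-trivial otherwise. The quermassintegrals $W_0(K),\dots,W_n(K)$ of $K\in\mathcal{K}^n$ are defined by the Steiner formula $\mathrm{Vol}(K+\rho B_n)=\sum_{i=0}^n\binom{n}{i}W_i(K)\rho^i$ for all $\rho\geq 0$, where $B_n$ is the Euclidean unit ball of $\mathbb{R}^n$, $+$ is Minkowski addition and $\mathrm{Vol}$ is $n$-dimensional Lebesgue measure; in particular $W_0=\mathrm{Vol}$. *)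

(* Defs.v *)
From HB Require Import structures.
From mathcomp Require Import all_boot all_order all_algebra.
From mathcomp Require Import all_classical all_reals all_analysis.
From mathcomp Require Import ring.

Set Implicit Arguments.
Unset Strict Implicit.
Unset Printing Implicit Defensive.

Import Order.TTheory GRing.Theory Num.Theory.
Import numFieldNormedType.Exports.

Local Open Scope classical_set_scope.
Local Open Scope ring_scope.

(* The norm `|x| that the library puts on 'cV[R]_n is the sup norm. *)
Definition enorm (R : realType) (n : nat) (x : 'cV[R]_n) : R :=
  Num.sqrt (\sum_(i < n) x i 0 ^+ 2).

Definition eball (R : realType) (n : nat) : set 'cV[R]_n :=
  [set x | enorm x <= 1].

Definition minkowski_sum (R : realType) (n : nat) (A B : set 'cV[R]_n) :
  set 'cV[R]_n := [set x + y | x in A & y in B].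

Definition dilate (R : realType) (n : nat) (a : R) (A : set 'cV[R]_n) :
  set 'cV[R]_n := [set a *: x | x in A].

Section enorm_lemmas.
Context (R : realType) (n : nat).
Implicit Types x y z : 'cV[R]_n.

Let sqs_ge0 x : 0 <= \sum_(i < n) x i 0 ^+ 2.
Proof. by apply: sumr_ge0 => i _; exact: sqr_ge0. Qed.

Lemma enorm_ge0 x : 0 <= enorm x.
Proof. exact: sqrtr_ge0. Qed.

Lemma enorm_sqr x : enorm x ^+ 2 = \sum_(i < n) x i 0 ^+ 2.
Proof. by rewrite sqr_sqrtr. Qed.

Lemma enorm0 : enorm (0 : 'cV[R]_n) = 0.
Proof.
rewrite /enorm big1 ?sqrtr0// => i _.
by rewrite mxE expr0n.
Qed.

Lemma enormZ (a : R) x : enorm (a *: x) = `|a| * enorm x.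
Proof.
rewrite /enorm -sqrtr_sqr -sqrtrM ?sqr_ge0//; congr Num.sqrt.
by rewrite mulr_sumr; apply: eq_bigr => i _; rewrite mxE exprMn.
Qed.

Lemma enormN x : enorm (- x) = enorm x.
Proof. by rewrite -scaleN1r enormZ normrN1 mul1r. Qed.

Lemma cauchy_schwarz x y : \sum_(i < n) x i 0 * y i 0 <= enorm x * enorm y.
Proof.
have [X0|X0] := eqVneq (enorm x) 0.
  have xE i : x i 0 = 0.
    have /eqP := enorm_sqr x; rewrite X0 expr0n/= eq_sym psumr_eq0; last first.
      by move=> *; exact: sqr_ge0.
    by move=> /allP/(_ i); rewrite mem_index_enum sqrf_eq0 => /(_ isT)/eqP.
  by rewrite X0 mul0r big1// => i _; rewrite xE mul0r.
have [Y0|Y0] := eqVneq (enorm y) 0.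
  have yE i : y i 0 = 0.
    have /eqP := enorm_sqr y; rewrite Y0 expr0n/= eq_sym psumr_eq0; last first.
      by move=> *; exact: sqr_ge0.
    by move=> /allP/(_ i); rewrite mem_index_enum sqrf_eq0 => /(_ isT)/eqP.
  by rewrite Y0 mulr0 big1// => i _; rewrite yE mulr0.
have Xp : 0 < enorm x by rewrite lt_neqAle eq_sym X0 enorm_ge0.
have Yp : 0 < enorm y by rewrite lt_neqAle eq_sym Y0 enorm_ge0.
have : 0 <= \sum_(i < n) (enorm y * x i 0 - enorm x * y i 0) ^+ 2.
  by apply: sumr_ge0 => i _; exact: sqr_ge0.
rewrite (eq_bigr (fun i => enorm y ^+ 2 * x i 0 ^+ 2
   + enorm x ^+ 2 * y i 0 ^+ 2
   - (enorm x * enorm y *+ 2) * (x i 0 * y i 0))); last by move=> i _; ring.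
rewrite sumrB big_split/= -!mulr_sumr -!enorm_sqr.
move: (\sum_(i < n) _) => s h.
have {}h : 0 <= (enorm x * enorm y *+ 2) * (enorm x * enorm y - s).
  by apply: le_trans h _; rewrite le_eqVlt; apply/orP; left; apply/eqP; ring.
by move: h; rewrite pmulr_rge0 ?subr_ge0// pmulrn_lgt0// mulr_gt0.
Qed.

Lemma ler_enormD x y : enorm (x + y) <= enorm x + enorm y.
Proof.
rewrite -ler_sqr ?nnegrE ?addr_ge0 ?enorm_ge0//.
rewrite enorm_sqr sqrrD !enorm_sqr.
rewrite (eq_bigr (fun i => x i 0 ^+ 2 + 2 * (x i 0 * y i 0) + y i 0 ^+ 2)).
  rewrite !big_split/= -mulr_sumr lerD2r lerD2l -[leRHS]mulr_natl.
  by rewrite ler_wpM2l// cauchy_schwarz.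
by move=> i _; rewrite mxE; ring.
Qed.

Lemma coord_le_enorm x i : `|x i 0| <= enorm x.
Proof.
rewrite -ler_sqr ?nnegrE ?enorm_ge0// enorm_sqr real_normK ?num_real//.
rewrite (bigD1 i)//= lerDl.
by apply: sumr_ge0 => j _; exact: sqr_ge0.
Qed.

Lemma normr_le_enorm x : `|x| <= enorm x.
Proof.
rewrite [leLHS]mx_normrE; apply: bigmax_le; first exact: enorm_ge0.
by move=> [i j] _ /=; rewrite (ord1 j) coord_le_enorm.
Qed.

Lemma enorm_le_normr x : enorm x <= n%:R * `|x|.
Proof.
rewrite -ler_sqr ?nnegrE ?enorm_ge0 ?mulr_ge0//.
apply: (@le_trans _ _ (n%:R * `|x| ^+ 2)).
  rewrite enorm_sqr mulr_natl.
  have [N NE] : exists N, N = `|x| ^+ 2 by eexists.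
  rewrite -NE.
  rewrite -[in leRHS](card_ord n) -sumr_const; apply: ler_sum => i _.
  rewrite NE -(real_normK (num_real _)) ler_sqr ?nnegrE//.
  by rewrite [leRHS]mx_normrE (le_bigmax _ (fun k => `|x k.1 k.2|) (i, 0)).
rewrite exprMn ler_wpM2r ?sqr_ge0// expr2 -natrM ler_nat.
by case: n => // m; rewrite leq_pmulr.
Qed.

Lemma eball_dilateP (e : R) x : 0 <= e ->
  dilate e (@eball R n) x <-> enorm x <= e.
Proof.
move=> e0; split=> [[y /= y1 <-]|xe].
  by rewrite enormZ ger0_norm// ler_piMr.
have [E|E] := eqVneq e 0.
  exists 0; first by rewrite /eball/= enorm0.
  rewrite scaler0; apply/esym/eqP; rewrite -normr_le0.
  by rewrite (le_trans (normr_le_enorm x))// -E.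
have ep : 0 < e by rewrite lt_neqAle eq_sym E e0.
exists (e^-1 *: x); last by rewrite scalerA divff// scale1r.
by rewrite /eball/= enormZ ger0_norm ?invr_ge0// mulrC ler_pdivrMr// mul1r.
Qed.

End enorm_lemmas.

Record convex_body (R : realType) (n : nat) := ConvexBody {
  body :> set 'cV[R]_n ;
  body_neq0 : body !=set0 ;
  body_compact : compact body ;
  body_convex : convex_set body }.

HB.instance Definition _ (R : realType) (n : nat) :=
  gen_eqMixin (convex_body R n).
HB.instance Definition _ (R : realType) (n : nat) :=
  gen_choiceMixin (convex_body R n).

Lemma body_inj (R : realType) (n : nat) : injective (@body R n).
Proof.
move=> [A a1 a2 a3] [B b1 b2 b3] /= AB; subst B.
by congr ConvexBody; exact: Prop_irrelevance.
Qed.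

Definition hausdorff_dist (R : realType) (n : nat)
    (K L : convex_body R n) : R :=
  inf [set e : R | [/\ 0 <= e,
    K `<=` minkowski_sum L (dilate e (@eball R n)) &
    L `<=` minkowski_sum K (dilate e (@eball R n))]].

Section hausdorff_metric.
Context (R : realType) (n : nat).
Implicit Types K L M : convex_body R n.

Let admissible K L : set R := [set e : R | [/\ 0 <= e,
    K `<=` minkowski_sum L (dilate e (@eball R n)) &
    L `<=` minkowski_sum K (dilate e (@eball R n))]].

Let sum_ballP (e : R) (A : set 'cV[R]_n) x : 0 <= e ->
  minkowski_sum A (dilate e (@eball R n)) x <->
  exists2 y, A y & enorm (x - y) <= e.
Proof.
move=> e0; split=> [[y Ay [z /(eball_dilateP _ e0) ze <-]]|[y Ay xy]].
  by exists y => //; rewrite addrAC subrr add0r.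
by exists y => //; exists (x - y); [exact/eball_dilateP|rewrite addrC subrK].
Qed.

Let body_bounded K : exists2 M : R, 0 <= M & forall x, body K x -> enorm x <= M.
Proof.
have [M [_ /(_ (M + 1))]] := compact_bounded (@body_compact _ _ K).
rewrite ltrDl => /(_ ltr01) KM.
exists (n%:R * `|M + 1|); first by rewrite mulr_ge0.
move=> x Kx; rewrite (le_trans (enorm_le_normr x))// ler_wpM2l//.
by rewrite (le_trans (KM _ Kx))// ler_norm.
Qed.

Let admissible_has_lb K L : has_lbound (admissible K L).
Proof. by exists 0 => e []. Qed.

Let admissible_neq0 K L : admissible K L !=set0.
Proof.
have [M M0 KM] := body_bounded K; have [N N0 LN] := body_bounded L.
have [x0 Kx0] := body_neq0 K; have [y0 Ly0] := body_neq0 L.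
have MN : 0 <= M + N by rewrite addr_ge0.
exists (M + N); split=> // z Hz; apply/sum_ballP => //.
  exists y0 => //; rewrite (le_trans (ler_enormD _ _))// enormN.
  by apply: lerD; [exact: KM|exact: LN].
exists x0 => //; rewrite (le_trans (ler_enormD _ _))// enormN addrC.
by apply: lerD; [exact: KM|exact: LN].
Qed.

Let hausdorff_ge0 K L : 0 <= hausdorff_dist K L.
Proof. by apply: lb_le_inf => [|e []//]; exact: admissible_neq0. Qed.

Let hausdorff_distxx K : hausdorff_dist K K = 0.
Proof.
apply/eqP; rewrite eq_le hausdorff_ge0 andbT.
apply: ge_inf; first exact: admissible_has_lb.
by split=> // x Kx; apply/sum_ballP => //; exists x => //; rewrite subrr enorm0.
Qed.

Let hausdorff_dist_sym K L : hausdorff_dist K L = hausdorff_dist L K.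
Proof.
by congr inf; apply/seteqP; split=> e [*]; split.
Qed.

Let hausdorff_dist_triangle L K M :
  hausdorff_dist K M <= hausdorff_dist K L + hausdorff_dist L M.
Proof.
apply/ler_addgt0Pl => e e0.
have e2 : 0 < e / 2 by rewrite divr_gt0.
have [a [a0 KL LK] aE] := inf_adherent e2 (conj (admissible_neq0 K L)
  (admissible_has_lb K L)).
have [b [b0 LM ML] bE] := inf_adherent e2 (conj (admissible_neq0 L M)
  (admissible_has_lb L M)).
apply: (@le_trans _ _ (a + b)); last first.
  by rewrite [e in leRHS]splitr addrACA ![e / 2 + _]addrC lerD// ltW.
apply: ge_inf; first exact: admissible_has_lb.
have ab : 0 <= a + b by rewrite addr_ge0.
split=> // x Hx; apply/sum_ballP => //.
  have [y Ly xy] := (sum_ballP _ _ a0).1 (KL _ Hx).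
  have [z Mz yz] := (sum_ballP _ _ b0).1 (LM _ Ly).
  exists z => //; rewrite (_ : x - z = (x - y) + (y - z)); last first.
    by rewrite addrA subrK.
  by rewrite (le_trans (ler_enormD _ _))// lerD.
have [y Ly xy] := (sum_ballP _ _ b0).1 (ML _ Hx).
have [z Mz yz] := (sum_ballP _ _ a0).1 (LK _ Ly).
exists z => //; rewrite (_ : x - z = (x - y) + (y - z)); last first.
  by rewrite addrA subrK.
by rewrite (le_trans (ler_enormD _ _))// addrC lerD.
Qed.

Let hausdorff_dist0_sub K L : hausdorff_dist K L = 0 -> K `<=` L.
Proof.
move=> KL0 x Kx.
have Lclosed : closed (L : set 'cV[R]_n).
  by apply: compact_closed; [exact: norm_hausdorff|exact: body_compact].
apply: Lclosed => B /nbhs_ballP[e /= e0 eB].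
have [a [a0 KL LK] aE] := inf_adherent e0 (conj (admissible_neq0 K L)
  (admissible_has_lb K L)).
have [y Ly xy] := (sum_ballP _ _ a0).1 (KL _ Kx).
exists y; split=> //; apply: eB; rewrite -ball_normE /ball_/=.
rewrite (le_lt_trans (normr_le_enorm _))// (le_lt_trans xy)//.
by rewrite -[e]add0r -KL0.
Qed.

Let hausdorff_dist_positivity K L : hausdorff_dist K L = 0 -> K = L.
Proof.
move=> KL0; apply: body_inj; apply/seteqP.
by split; apply: hausdorff_dist0_sub => //; rewrite hausdorff_dist_sym.
Qed.

HB.instance Definition _ := @isMetric.Build R (convex_body R n)
  (@hausdorff_dist R n) hausdorff_distxx hausdorff_dist_positivity
  hausdorff_dist_sym hausdorff_dist_triangle.

End hausdorff_metric.

Section linear_image.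
Context (R : realType) (n : nat) (g : 'M[R]_n) (K : convex_body R n).

Definition linear_image_set : set 'cV[R]_n := [set g *m x | x in K].

Lemma linear_image_neq0 : linear_image_set !=set0.
Proof. by have [x Kx] := body_neq0 K; exists (g *m x), x. Qed.

Lemma mulmx_continuous : continuous (fun x : 'cV[R]_n => g *m x).
Proof.
move=> x; apply/(@cvgrPdist_le _ _ _ (nbhs x)) => e e0.
pose C := 1 + \sum_i \sum_j `|g i j|.
have C0 : 0 < C.
  by rewrite ltr_pwDl// sumr_ge0// => i _; rewrite sumr_ge0.
near=> y.
have xy : `|x - y| <= e / C.
  near: y; apply/nbhs_ballP; exists (e / C) => /=; first by rewrite divr_gt0.
  by move=> y; rewrite -ball_normE /ball_/= => /ltW.
rewrite -mulmxBr [leLHS]mx_normrE; apply: bigmax_le; first exact: ltW.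
move=> [i k] _ /=; rewrite (ord1 k) mxE (le_trans (ler_norm_sum _ _ _))//.
apply: (@le_trans _ _ (\sum_j `|g i j| * (e / C))).
  apply: ler_sum => j _; rewrite normrM ler_wpM2l//.
  apply: le_trans xy; rewrite [leRHS]mx_normrE.
  exact: (le_bigmax _ (fun k => `|(x - y) k.1 k.2|) (j, 0)).
rewrite -mulr_suml mulrCA ler_piMr//; first exact: ltW.
rewrite ler_pdivrMr// mul1r /C [in leRHS](bigD1 i)//= addrCA lerDl addr_ge0//.
by rewrite sumr_ge0// => j _; rewrite sumr_ge0.
Unshelve. all: by end_near. Qed.

Lemma linear_image_compact : compact linear_image_set.
Proof.
apply: continuous_compact; last exact: body_compact.
by apply: continuous_subspaceT; exact: mulmx_continuous.
Qed.

Lemma linear_image_convex : convex_set linear_image_set.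
Proof.
move=> _ _ t /set_mem[x Kx <-] /set_mem[y Ky <-]; apply/mem_set.
exists (conv t (x : convex_lmodType 'cV[R]_n) y).
  by apply/set_mem/body_convex; exact/mem_set.
by rewrite /conv/= mulmxDr !scalemxAr.
Qed.

Definition linear_image : convex_body R n :=
  ConvexBody linear_image_neq0 linear_image_compact linear_image_convex.

End linear_image.

Definition GL_covariant (R : realType) (n : nat)
    (D : convex_body R n -> convex_body R n) :=
  forall (g : 'M[R]_n) (K : convex_body R n),
    g \in unitmx -> D (linear_image g K) = linear_image g (D K).

Definition trivial_operator (R : realType) (n : nat)
    (D : convex_body R n -> convex_body R n) :=
  forall K : convex_body R n, (D K : set 'cV[R]_n) = [set 0].

Section lebesgue_product.
Context (R : realType).
Local Notation tup n := (n.-tuple (measurableTypeR R)).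

Definition tuple_cons (n : nat) (p : measurableTypeR R * tup n) : tup n.+1 :=
  [tuple of p.1 :: p.2].

Lemma measurable_tuple_cons n : measurable_fun [set: _] (@tuple_cons n).
Proof. exact: measurable_cons. Qed.

Definition tuple_uncons (n : nat) (t : tup n.+1) : measurableTypeR R * tup n :=
  (thead t, [tuple of behead t]).

Lemma measurable_tuple_uncons n : measurable_fun [set: _] (@tuple_uncons n).
Proof.
apply/measurable_fun_pairP; split; last exact: measurable_behead.
exact: measurable_tnth.
Qed.

Lemma tuple_consK n : cancel (@tuple_cons n) (@tuple_uncons n).
Proof. by move=> [x t]; congr pair; apply: val_inj. Qed.

Section lebesgue_cons.
Context (n : nat) (m : {sigma_finite_measure set (tup n) -> \bar R}).
Local Open Scope ereal_scope.

Definition lebesgue_cons : set (tup n.+1) -> \bar R :=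
  pushforward (@lebesgue_measure R \x m) (@tuple_cons n).

Let preimage_measurable A : measurable A -> measurable (@tuple_cons n @^-1` A).
Proof.
by move=> mA; rewrite -[X in measurable X]setTI; exact: measurable_tuple_cons.
Qed.

Let lebesgue_cons0 : lebesgue_cons set0 = 0.
Proof. by rewrite /lebesgue_cons /pushforward preimage_set0 measure0. Qed.

Let lebesgue_cons_ge0 A : 0 <= lebesgue_cons A.
Proof. by rewrite /lebesgue_cons /pushforward measure_ge0. Qed.

Let lebesgue_cons_sigma_additive : semi_sigma_additive lebesgue_cons.
Proof.
move=> F mF tF mUF; rewrite /lebesgue_cons /pushforward preimage_bigcup.
apply: measure_semi_sigma_additive.
- by move=> k; exact: preimage_measurable.
- apply/trivIsetP => /= i j _ _ ij; rewrite -preimage_setI.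
  by move/trivIsetP : tF => /(_ _ _ _ _ ij) ->//; rewrite preimage_set0.
- by rewrite -preimage_bigcup; exact: preimage_measurable.
Qed.

HB.instance Definition _ := isMeasure.Build _ _ _ lebesgue_cons
  lebesgue_cons0 lebesgue_cons_ge0 lebesgue_cons_sigma_additive.

Let product_sigma_finite : sigma_finite setT (@lebesgue_measure R \x m).
Proof.
have /sigma_finiteP[F [TF ndF Foo]] := sigma_finiteT (@lebesgue_measure R).
have /sigma_finiteP[G [TG ndG Goo]] := sigma_finiteT m.
exists (fun k => F k `*` G k).
  rewrite -setXTT TF TG predeqE => -[x y]; split.
    move=> [/= [i _ Fix] [j _ Gjy]]; exists (maxn i j) => //; split.
    - by move: x Fix; exact/subsetPset/ndF/leq_maxl.
    - by move: y Gjy; exact/subsetPset/ndG/leq_maxr.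
  by move=> [i _ []/= ? ?]; split; exists i.
move=> k; have [? ?] := Foo k; have [? ?] := Goo k.
split; first exact: measurableX.
by rewrite product_measure1E// lte_mul_pinfty// ge0_fin_numE.
Qed.

Let lebesgue_cons_sigma_finite : sigma_finite setT lebesgue_cons.
Proof.
have [F FT Foo] := product_sigma_finite.
exists (fun k => @tuple_uncons n @^-1` F k).
  by rewrite -preimage_bigcup -FT preimage_setT.
move=> k; have [mF Fk] := Foo k; split.
  by rewrite -[X in measurable X]setTI; exact: measurable_tuple_uncons.
rewrite /lebesgue_cons /pushforward -comp_preimage.
rewrite (_ : _ \o _ = id) ?preimage_id//.
by apply/funext => p; exact: tuple_consK.
Qed.

HB.instance Definition _ := Measure_isSigmaFinite.Build _ _ _ lebesgue_cons
  lebesgue_cons_sigma_finite.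

End lebesgue_cons.

(* The n-fold product of the Lebesgue measure of the line; on 0-tuples it is
   the unit mass. *)
Fixpoint lebesgue_tuple (n : nat) :
    {sigma_finite_measure set (tup n) -> \bar R} :=
  match n with
  | 0 => \d_([tuple] : tup 0)
  | k.+1 => lebesgue_cons (lebesgue_tuple k)
  end.

End lebesgue_product.

Definition volume (R : realType) (n : nat) (A : set 'cV[R]_n) : \bar R :=
  lebesgue_tuple R n [set t | A (\col_i tnth t i)].

Definition steiner_formula (R : realType) (n : nat) (K : convex_body R n)
    (w : {ffun 'I_n.+1 -> R}) :=
  forall rho : R, 0 <= rho ->
    volume (minkowski_sum K (dilate rho (@eball R n))) =
    (\sum_(i < n.+1) 'C(n, i)%:R * w i * rho ^+ i)%:E.

(* There is at most one w satisfying the Steiner formula of K, the right-hand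
   side being a polynomial in rho with nonzero binomial factors; the default 0
   is a junk value, as by Steiner's theorem such a w exists. *)
Definition quermassintegral (R : realType) (n : nat) (i : 'I_n.+1)
    (K : convex_body R n) : R :=
  xget 0 [set w | steiner_formula K w] i.

(* Main.v *)
(* By continuity the covariance of [D] extends from GL(n) to all matrices. Applying
   rank-one matrices shows that the projection of [D K] to a line is determined by
   that of [K]: if [M = D [e_0, e_1]] then <u, D K> = {a m_0 + b m_1 | m in M} when
   <u, K> = [a, b]. If [M] lies on the diagonal, evaluating on the simplex forces
   [D] to be trivial. Otherwise the width of [D K] is at least a constant multiple
   of that of [K], so that [D K], having bounded asymmetry, contains a translate of
   a fixed dilate of [K], and the quermassintegrals are monotone.

   Steiner's formula and the monotonicity of its coefficients are first obtained
   with a zonotope in place of the ball: adding a segment [-w, w] to [A] adds to the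
   volume 2 |w| times the volume of the projection of [A] along [w], so induction on
   the number of segments and the dimension gives a polynomial whose coefficients
   are nonnegative and monotone in [A]. The ball is a limit of zonotopes because
   the mean of |<u, x>| over the ball is a multiple of |u|. *)
Require Import Defs.
From mathcomp Require Import all_boot all_order all_algebra.
From mathcomp Require Import all_classical all_reals all_analysis measurable_realfun.
From mathcomp Require Import perm ring lra.

Set Implicit Arguments.
Unset Strict Implicit.
Unset Printing Implicit Defensive.

Import Order.TTheory GRing.Theory Num.Theory.
Import numFieldNormedType.Exports.

Local Open Scope classical_set_scope.
Local Open Scope ring_scope.

(** * Change of variables for the product Lebesgue measure *)

Section lebesgue_tuple_theory.
Context (R : realType).
Local Notation tup n := (n.-tuple (measurableTypeR R)).
Local Notation leb := (@lebesgue_measure R).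
Local Notation mu n := (lebesgue_tuple R n).

(** Comparing widths only relates [K - K] to [D K - D K]; bounded asymmetry is what turns this into
    a statement about [D K] itself. It has to cover bodies with empty interior, since [K] and [D K]
    may be flat, so it is proved relative to the affine hull. As [quermassintegral] is selected by
    [xget], nothing is known about it until a solution of Steiner's formula is exhibited. The
    approximating zonotopes give polynomials of fixed degree whose coefficients are fixed linear
    combinations of finitely many values. Convergence of volumes therefore forces convergence of
    coefficients, and signs and monotonicity survive the limit. Segments point in arbitrary
    directions while Fubini works along coordinate axes. Rotation invariance of the product measure
    bridges the two, and the same invariance makes the mean of |<u, x>| over the ball depend on |u|
    only. *)

Lemma measurable_preimage d d' (T : measurableType d) (U : measurableType d')
    (f : T -> U) (A : set U) :
  measurable_fun setT f -> measurable A -> measurable (f @^-1` A).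
Proof. by move=> mf mA; rewrite -[X in measurable X]setTI; exact: mf. Qed.

Lemma measurable_affine (a b : R) :
  measurable_fun [set: measurableTypeR R]
    (fun x : measurableTypeR R => (a * x + b : R) : measurableTypeR R).
Proof. by apply: measurable_funD => //; exact: measurable_funM. Qed.

Lemma affine_preimage_ocitv (a b : R) (x y : R) : 0 < a ->
  (fun z : R => a * z + b) @^-1` `]x, y] = `](x - b) / a, (y - b) / a]%classic.
Proof.
move=> a0; apply/seteqP; split => z /=; rewrite !in_itv/=;
  by rewrite ltr_pdivrMr// ler_pdivlMr// ltrBlDr lerBrDr mulrC.
Qed.

(** The rescaled pushforward agrees with the Lebesgue measure on half-open intervals, and these
    determine it. *)
Lemma lebesgue_measure_affine_gt0 (a b : R) (A : set (measurableTypeR R)) :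
  0 < a -> measurable A ->
  (a%:E * leb ((fun z : measurableTypeR R => (a * z + b : R)%R) @^-1` A) = leb A)%E.
Proof.
move=> a0 mA; have a0' : 0 <= a by exact: ltW.
pose f := fun z : measurableTypeR R => ((a * z + b : R) : measurableTypeR R).
have mf : measurable_fun setT f by exact: measurable_affine.
pose nu : {measure set (measurableTypeR R) -> \bar R} :=
  [the measure _ _ of pushforward leb f].
apply/esym.
rewrite (@lebesgue_measure_unique _ (mscale (NngNum a0') (nu mf)))//.
move=> _ [[x y]] _ <-; rewrite /mscale/= /pushforward /f.
rewrite [X in _ = (_ * X)%E](_ : _ = leb `](x - b) / a, (y - b) / a]%classic);
  last by congr (leb _); exact: affine_preimage_ocitv.
rewrite !lebesgue_measure_itv/= !lte_fin.
rewrite ltr_pM2r ?invr_gt0// ltrD2r; case: ifPn => _; last by rewrite mule0.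
by rewrite -!EFinD -EFinM; congr (_%:E); field; rewrite gt_eqF.
Qed.

Lemma lebesgue_measure_affine (a b : R) (A : set (measurableTypeR R)) :
  a != 0 -> measurable A ->
  (`|a|%:E * leb ((fun z : measurableTypeR R => (a * z + b : R)%R) @^-1` A) = leb A)%E.
Proof.
move=> a0 mA; have [ap|an] := ltP 0 a.
  by rewrite gtr0_norm// lebesgue_measure_affine_gt0.
have {}an : a < 0 by rewrite lt_neqAle a0.
rewrite ltr0_norm//.
have mN : measurable ((-%R : _ -> measurableTypeR R) @^-1` A).
  exact: measurable_preimage (@oppr_measurable _ _) mA.
transitivity (leb ((-%R : _ -> measurableTypeR R) @^-1` A)); last first.
  exact: lebesgue_measureN.
rewrite -(@lebesgue_measure_affine_gt0 (- a) (- b) _ _ mN) ?oppr_gt0//.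
congr (_ * _)%E; congr (leb _).
by apply: eq_set => z /=; congr (A _); ring.
Qed.

End lebesgue_tuple_theory.

Section lebesgue_tuple_affine.
Context (R : realType).
Local Notation tup n := (n.-tuple (measurableTypeR R)).
Local Notation leb := (@lebesgue_measure R).
Local Notation mu n := (lebesgue_tuple R n).

Definition vec_of_tuple n (t : tup n) : 'cV[R]_n := \col_i tnth t i.

Definition tuple_of_vec n (v : 'cV[R]_n) : tup n := [tuple v i 0 | i < n].

Lemma vec_of_tupleK n : cancel (@vec_of_tuple n) (@tuple_of_vec n).
Proof. by move=> t; apply: eq_from_tnth => i; rewrite tnth_mktuple mxE. Qed.

Lemma tuple_of_vecK n : cancel (@tuple_of_vec n) (@vec_of_tuple n).
Proof.
by move=> v; apply/matrixP => i j; rewrite mxE tnth_mktuple (ord1 j).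
Qed.

Lemma vec_of_tuple_cons n (x : R) (t : tup n) :
  vec_of_tuple (tuple_cons (x, t)) = col_mx x%:M (vec_of_tuple t) :> 'cV_(1 + n).
Proof.
apply/matrixP => i j; rewrite (ord1 j) !mxE; case: splitP => k.
  rewrite (ord1 k) => /= i0; rewrite mxE eqxx mulr1n.
  by rewrite (_ : i = ord0) ?tnth0//; apply: val_inj.
move=> ik; rewrite mxE (_ : i = lift ord0 k) ?tnthS; last exact: val_inj.
by congr tnth; apply: val_inj.
Qed.

Lemma tuple_of_vec_col_mx n (x : R) (v : 'cV[R]_n) :
  tuple_of_vec (col_mx x%:M v : 'cV_(1 + n)) = tuple_cons (x, tuple_of_vec v).
Proof.
apply: (can_inj (@vec_of_tupleK _)).
by rewrite tuple_of_vecK vec_of_tuple_cons tuple_of_vecK.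
Qed.

Lemma measurable_tuple_consr n (x : measurableTypeR R) :
  measurable_fun setT (fun t : tup n => tuple_cons (x, t)).
Proof. by apply: (@measurable_cons _ _ _ _ (fun=> x) n id). Qed.

Lemma measurable_tuple_consl n (t : tup n) :
  measurable_fun setT (fun x : measurableTypeR R => tuple_cons (x, t)).
Proof. by apply: (@measurable_cons _ _ _ _ id n (fun=> t)). Qed.

Lemma lebesgue_tuple_xsection n (A : set (tup n.+1)) : measurable A ->
  mu n.+1 A = (\int[leb]_x mu n [set t | A (tuple_cons (x, t))])%E.
Proof.
move=> mA; transitivity ((leb \x mu n) (@tuple_cons R n @^-1` A))%E => //.
apply: eq_integral => x _; rewrite /=.
by congr (mu n _); apply/seteqP; split => t; rewrite /xsection/= inE.
Qed.

(** Slicing by the first coordinate is the definition of the product measure; this other order of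
    integration rests on uniqueness of that measure. *)
Lemma lebesgue_tuple_ysection n (A : set (tup n.+1)) : measurable A ->
  mu n.+1 A = (\int[mu n]_t leb [set x | A (tuple_cons (x, t))])%E.
Proof.
move=> mA; transitivity ((leb \x mu n) (@tuple_cons R n @^-1` A))%E => //.
rewrite (@product_measure_unique _ _ _ _ _ _ _ (leb \x^ mu n)%E)//=.
- apply: eq_integral => x _; rewrite /=.
  by congr (leb _); apply/seteqP; split => t; rewrite /ysection/= inE.
- by move=> B C mB mC; rewrite product_measure2E.
- exact: measurable_preimage (@measurable_tuple_cons _ _) mA.
Qed.

Lemma measurable_lebesgue_xsection n (A : set (tup n.+1)) : measurable A ->
  measurable_fun setT (fun x => mu n [set t | A (tuple_cons (x, t))]).
Proof.
move=> mA.
rewrite [X in measurable_fun _ X](_ : _ = mu n \o xsection (@tuple_cons R n @^-1` A)).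
  apply: measurable_fun_xsection.
  exact: measurable_preimage (@measurable_tuple_cons _ _) mA.
apply/funext => x/=.
by congr (mu n _); apply/seteqP; split => t; rewrite /xsection/= inE.
Qed.

Lemma measurable_lebesgue_ysection n (A : set (tup n.+1)) : measurable A ->
  measurable_fun setT (fun t => leb [set x | A (tuple_cons (x, t))]).
Proof.
move=> mA.
rewrite [X in measurable_fun _ X](_ : _ = leb \o ysection (@tuple_cons R n @^-1` A)).
  apply: measurable_fun_ysection.
  exact: measurable_preimage (@measurable_tuple_cons _ _) mA.
apply/funext => x/=.
by congr (leb _); apply/seteqP; split => t; rewrite /ysection/= inE.
Qed.

Definition affine_tuple n (g : 'M[R]_n) (v : 'cV[R]_n) (t : tup n) : tup n :=
  tuple_of_vec (g *m vec_of_tuple t + v).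

Lemma measurable_affine_tuple n (g : 'M[R]_n) (v : 'cV[R]_n) :
  measurable_fun setT (affine_tuple g v).
Proof.
apply/measurable_fun_tnthP => i.
rewrite (_ : _ \o _ = fun t : tup n => (\sum_j g i j * tnth t j) + v i 0).
  apply: measurable_funD => //.
  apply: measurable_sum => j; apply: measurable_funM => //.
  exact: measurable_tnth.
apply/funext => t /=; rewrite tnth_mktuple !mxE; congr (_ + _).
by apply: eq_bigr => j _; rewrite mxE.
Qed.

(** Phrased with preimages, so that no inverse matrix appears and composition of maps is
    substitution. *)
Definition affine_scales n (g : 'M[R]_n) (v : 'cV[R]_n) :=
  forall A, measurable A ->
    (`|\det g|%:E * mu n [set t | A (affine_tuple g v t)] = mu n A)%E.

Lemma affine_scalesM n (g h : 'M[R]_n) v w :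
  affine_scales g v -> affine_scales h w -> affine_scales (g *m h) (g *m w + v).
Proof.
move=> gv hw A mA; rewrite det_mulmx normrM EFinM -muleA.
have mB : measurable [set t | A (affine_tuple g v t)].
  exact: measurable_preimage (measurable_affine_tuple g v) mA.
rewrite -[RHS]gv// -[in RHS]hw//; congr (_ * (_ * mu n _))%E.
apply: eq_set => t; congr (A (tuple_of_vec _)).
by rewrite tuple_of_vecK mulmxDr mulmxA addrA.
Qed.

(** With the tail [t] fixed, the first coordinate undergoes an affine map of slope [a], whose
    constant term depends on [t]; integrate over [t]. *)
Lemma affine_scales_upper n (a : R) (r : 'rV[R]_n) (b : R) : a != 0 ->
  affine_scales (block_mx a%:M r 0 1%:M : 'M[R]_(1 + n)) (col_mx b%:M 0).
Proof.
move=> a0 A mA.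
rewrite det_ublock det_scalar1 det1 mulr1.
set h := affine_tuple _ _.
have mhA : measurable [set t | A (h t)].
  exact: measurable_preimage (measurable_affine_tuple _ _) mA.
rewrite !lebesgue_tuple_ysection// -ge0_integralZl//; last first.
  exact: (measurable_lebesgue_ysection mhA).
apply: eq_integral => t _ /=.
have mB : measurable [set x | A (tuple_cons (x, t))].
  exact: measurable_preimage (measurable_tuple_consl t) mA.
rewrite -(lebesgue_measure_affine ((r *m vec_of_tuple t) 0 0 + b) a0 mB).
congr (_ * leb _)%E; apply: eq_set => x /=; congr (A _).
rewrite /h /affine_tuple (vec_of_tuple_cons x t) mul_block_col add_col_mx addr0.
rewrite mul0mx mul1mx add0r -scalar_mxM [(r *m _)]mx11_scalar -!raddfD/=.
by rewrite tuple_of_vec_col_mx vec_of_tupleK ?addrA [_%:M 0 0]mxE eqxx mulr1n.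
Qed.

(** With the first coordinate [x] fixed, the tail undergoes [S] followed by a translation depending
    on [x]; hence the hypothesis for all [v]. *)
Lemma affine_scales_lower n (c : 'cV[R]_n) (S : 'M[R]_n) (w : 'cV[R]_n) :
  (forall v, affine_scales S v) ->
  affine_scales (block_mx 1%:M 0 c S : 'M[R]_(1 + n)) (col_mx 0 w).
Proof.
move=> IH A mA.
rewrite det_lblock det1 mul1r.
set h := affine_tuple _ _.
have mhA : measurable [set t | A (h t)].
  exact: measurable_preimage (measurable_affine_tuple _ _) mA.
rewrite !lebesgue_tuple_xsection// -ge0_integralZl//; last first.
  exact: (measurable_lebesgue_xsection mhA).
apply: eq_integral => x _ /=.
have mB : measurable [set t | A (tuple_cons (x, t))].
  exact: measurable_preimage (measurable_tuple_consr x) mA.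
rewrite -(IH (c *m x%:M + w) _ mB).
congr (_ * mu n _)%E; apply: eq_set => t /=; congr (A _).
rewrite /h {1}/affine_tuple (vec_of_tuple_cons x t) mul_block_col add_col_mx addr0.
by rewrite mul0mx addr0 mul1mx tuple_of_vec_col_mx /affine_tuple addrCA addrA.
Qed.

(** Induction on the dimension through a block LU factorization, which requires a nonzero corner
    entry. *)
Lemma affine_scales_unit n (g : 'M[R]_n) (v : 'cV[R]_n) :
  g \in unitmx -> affine_scales g v.
Proof.
elim: n g v => [|n IH] g v gU A mA.
  rewrite det_mx00 normr1 mul1e; congr (mu 0 _); apply/seteqP.
  by split=> t /=; rewrite (tuple0 (affine_tuple _ _ _)) (tuple0 t).
suff pivot (h : 'M[R]_(1 + n)) (w : 'cV[R]_(1 + n)) : h \in unitmx ->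
    h 0 0 != 0 -> affine_scales h w.
  have [g0|g0] := boolP (g 0 0 == 0); last exact: pivot.
  (* If the corner vanishes, the rest [c] of the first column does not, by invertibility. The shear
     [U c^T] then makes the corner equal to the squared norm of [c], and [U (- c^T)] undoes the
     shear. *)
  pose h : 'M[R]_(1 + n) := g; pose c := dlsubmx h.
  pose U (s : 'rV[R]_n) : 'M[R]_(1 + n) := block_mx 1%:M s 0 1%:M.
  have UK s : U s *m U (- s) = 1%:M.
    rewrite mulmx_block !mul1mx !mulmx1 !mul0mx !mulmx0 !addr0 addNr add0r.
    by rewrite -scalar_mx_block.
  have UK' s : U (- s) *m U s = 1%:M by rewrite -{2}[s]opprK UK.
  have cc : (c^T *m c) 0 0 != 0.
    apply/negP => /eqP cc0.
    have c0 : c = 0.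
      apply/matrixP => i j; rewrite (ord1 j) [RHS]mxE; apply/eqP.
      move/eqP: cc0; rewrite mxE psumr_eq0 => [/allP/(_ i)|k _]; last first.
        by rewrite mxE -expr2 sqr_ge0.
      by rewrite mem_index_enum mxE -expr2 sqrf_eq0 => /(_ isT).
    move: (gU : h \in unitmx); rewrite unitmxE -[h]submxK -/c c0.
    have -> : ulsubmx h = 0.
      apply/matrixP => i j; rewrite !mxE (ord1 i) (ord1 j) lshift0.
      exact/eqP.
    by rewrite det_ublock det0 mul0r unitr0.
  have UU : U c^T \in unitmx.
    by rewrite unitmxE det_ublock !det1 mulr1 unitr1.
  have hU : U c^T *m h \in unitmx by rewrite unitmx_mul UU.
  have -> : g = U (- c^T) *m (U c^T *m h).
    by rewrite mulmxA UK' mul1mx.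
  have -> : v = U (- c^T) *m (U c^T *m v) + col_mx 0%:M 0.
    rewrite mulmxA UK' mul1mx.
    by rewrite raddf0 col_mx0 addr0.
  move: A mA; apply: affine_scalesM.
    exact: affine_scales_upper (oner_neq0 _).
  apply: pivot => //.
  rewrite -[h]submxK mulmx_block -/c mul1mx.
  have -> : ulsubmx h = 0.
    apply/matrixP => i j; rewrite !mxE (ord1 i) (ord1 j) lshift0.
    exact/eqP.
  have -> : (0 : 'I_(1 + n)) = lshift n 0 by exact: val_inj.
  by rewrite block_mxEul add0r.
move=> hU h0.
pose a := h 0 0; pose c := dlsubmx h; pose r := ursubmx h.
(* The lower right block is the Schur complement of the pivot [a]. *)
pose L : 'M[R]_(1 + n) := block_mx 1%:M 0 (a^-1 *: c) (drsubmx h - a^-1 *: (c *m r)).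
pose U : 'M[R]_(1 + n) := block_mx a%:M r 0 1%:M.
have hLU : h = L *m U.
  rewrite -{1}[h]submxK mulmx_block !mul1mx !mul0mx !mulmx0 !addr0 mulmx1.
  congr block_mx.
  - by rewrite [LHS]mx11_scalar 2!mxE /a; congr (h _ _)%:M; exact: val_inj.
  - by rewrite -scalemxAl mul_mx_scalar scalerA mulVf// scale1r.
  - by rewrite -scalemxAl addrC subrK.
have SU : drsubmx h - a^-1 *: (c *m r) \in unitmx.
  have : L *m U \in unitmx by rewrite -hLU.
  rewrite unitmx_mul => /andP[+ _].
  by rewrite unitmxE det_lblock det1 mul1r.
pose b := w 0 0.
have -> : w = L *m col_mx b%:M 0 + col_mx 0 (dsubmx w - (a^-1 *: c) *m b%:M).
  rewrite mul_block_col mulmx0 mul1mx !addr0 mulmx0 addr0 add_col_mx addr0.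
  rewrite addrC subrK -[LHS]vsubmxK; congr col_mx.
  by rewrite [LHS]mx11_scalar mxE /b; congr (w _ _)%:M; exact: val_inj.
rewrite hLU; apply: affine_scalesM.
  by apply: affine_scales_lower => v'; exact: IH.
exact: affine_scales_upper.
Qed.

End lebesgue_tuple_affine.

(** * Volume of compact sets *)

Section volume_theory.
Context (R : realType).
Local Notation tup n := (n.-tuple (measurableTypeR R)).
Local Notation leb := (@lebesgue_measure R).
Local Notation mu n := (lebesgue_tuple R n).

Lemma measurable_tuple_forall n (F : 'I_n -> set (measurableTypeR R)) :
  (forall i, measurable (F i)) ->
  measurable [set t : tup n | forall i, F i (tnth t i)].
Proof.
move=> mF; rewrite (_ : [set _ | _] =
    \bigcap_(i in [set: 'I_n]) ((fun t : tup n => tnth t i) @^-1` F i)).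
  by apply: fin_bigcap_measurable => // i _;
    exact: measurable_preimage (measurable_tnth i) (mF i).
by apply/seteqP; split=> t /= h i; [move=> _|]; exact: h.
Qed.

Lemma ball_cVP n (x y : 'cV[R]_n) e :
  0 < e -> (forall i, `|x i 0 - y i 0| < e) -> ball x e y.
Proof. by move=> e0 h; split=> // i j; rewrite (ord1 j); exact: h. Qed.

(** Links the topology of column vectors to the product sigma-algebra of tuples: the complement is a
    countable union of boxes with rational centre and radius 1/(k+1). *)
Lemma closed_measurable_tuple n (A : set 'cV[R]_n) : closed A ->
  measurable [set t : tup n | A (vec_of_tuple t)].
Proof.
move=> cA.
pose box (p : nat * n.-tuple rat) : set (tup n) :=
  [set t | forall i, ball (ratr (tnth p.2 i) : R) (p.1.+1%:R^-1) (tnth t i)].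
pose F p := if `[< box p `<=` [set t | ~ A (vec_of_tuple t)] >]
            then box p else set0.
rewrite (_ : [set t | _] = ~` \bigcup_p F p); last first.
  apply/seteqP; split=> t /=.
    move=> At [p _]; rewrite /F; case: asboolP => // sub /sub; exact.
  apply: contra_notP => nA.
  have /nbhs_ballP[e /= e0 eA] : nbhs (vec_of_tuple t) (~` A).
    by apply: open_nbhs_nbhs; split=> //; exact: closed_openC.
  (* The box found below contains [t] but is centred elsewhere, so its radius must be below half of
     [e]. *)
  have [k ke] : exists k, k.+1%:R^-1 < e / 2.
    have := @near_infty_natSinv_lt R (PosNum (divr_gt0 e0 (ltr0n _ 2))).
    by move=> [N _ /(_ N (leqnn _)) /= h]; exists N.
  have /choice[q qP] : forall i, exists q : rat,
      `|ratr q - (tnth t i : R)| < k.+1%:R^-1.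
    move=> i.
    have k0 : 0 < k.+1%:R^-1 :> R by rewrite invr_gt0.
    have : (tnth t i : R) - k.+1%:R^-1 < (tnth t i : R) + k.+1%:R^-1.
      by rewrite ltrBlDr -addrA ltrDl addr_gt0.
    move=> /rat_in_itvoo[q]; rewrite inE => /itvP h0.
    by exists q; rewrite ltr_distl !h0.
  exists (k, [tuple q i | i < n]) => //.
  rewrite /F; case: asboolP => [_|[]] /=.
    by move=> i; rewrite tnth_mktuple; exact: qP.
  move=> s sb; apply: eA; apply: ball_cVP => // i; rewrite !mxE.
  have := sb i; rewrite /= tnth_mktuple; have := qP i.
  rewrite -ball_normE/= => h1 h2.
  rewrite (le_lt_trans (ler_distD (ratr (q i)) _ _))//.
  by move: h1 h2 ke; rewrite distrC; set d := _^-1; lra.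
apply: measurableC; apply: countable_bigcupT_measurable => // p.
rewrite /F; case: ifP => _; last exact: measurable0.
apply: (@measurable_tuple_forall n (fun i => ball (ratr (tnth p.2 i) : R)
  p.1.+1%:R^-1)) => i.
exact: measurable_ball.
Qed.

Lemma compact_measurable_tuple n (A : set 'cV[R]_n) : compact A ->
  measurable [set t : tup n | A (vec_of_tuple t)].
Proof.
move=> cA; apply: closed_measurable_tuple.
by apply: compact_closed => //; exact: norm_hausdorff.
Qed.

Lemma volumeE n (A : set 'cV[R]_n) : volume A = mu n [set t | A (vec_of_tuple t)].
Proof. by []. Qed.

Lemma volume_ge0 n (A : set 'cV[R]_n) : (0 <= volume A)%E.
Proof. exact: measure_ge0. Qed.

Lemma le_volume n (A B : set 'cV[R]_n) : compact A -> compact B ->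
  A `<=` B -> (volume A <= volume B)%E.
Proof.
move=> cA cB AB; apply: le_measure; rewrite ?inE; [exact: compact_measurable_tuple..|].
by move=> t; exact: AB.
Qed.

Lemma affine_continuous n m (g : 'M[R]_(m, n)) (v : 'cV[R]_m) :
  continuous (fun x : 'cV[R]_n => g *m x + v).
Proof.
have -> : (fun x : 'cV[R]_n => g *m x + v) = (fun x => \sum_j x j 0 *: col j g + v).
  apply/funext => x; congr (_ + _); apply/matrixP => i k.
  by rewrite (ord1 k) summxE mxE; apply: eq_bigr => j _; rewrite !mxE mulrC.
move=> x; apply: (@cvgD _ _ _ (nbhs x)); last exact: cvg_cst.
apply: (@cvg_big _ _ _ _ _ _ _ (nbhs x)) => [|j _]; first exact: add_continuous.
by apply: (@cvgZr_tmp _ _ _ (nbhs x)); exact: coord_continuous.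
Qed.

Lemma affine_image_compact n m (g : 'M[R]_(m, n)) (v : 'cV[R]_m) A : compact A ->
  compact [set g *m x + v | x in A].
Proof.
by move=> cA; apply: continuous_compact => //; apply: continuous_subspaceT;
  exact: affine_continuous.
Qed.

Lemma volume_affine n (g : 'M[R]_n) (v : 'cV[R]_n) A : g \in unitmx -> compact A ->
  volume [set g *m x + v | x in A] = (`|\det g|%:E * volume A)%E.
Proof.
move=> gU cA; rewrite [LHS]volumeE -(affine_scales_unit v gU); last first.
  by apply: compact_measurable_tuple; exact: affine_image_compact.
congr (_ * mu n _)%E; apply/seteqP; split=> t /=.
  move=> [x Ax]; rewrite tuple_of_vecK => /addIr.
  by move=> /(congr1 (mulmx (invmx g))); rewrite !mulKmx// => xt;
    rewrite /vec_of_tuple in xt; rewrite -xt.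
by move=> At; exists (vec_of_tuple t) => //; rewrite tuple_of_vecK.
Qed.

Lemma tnth_tuple_consS n (x : measurableTypeR R) (t : tup n) i :
  tnth (tuple_cons (x, t)) (lift ord0 i) = tnth t i.
Proof. by rewrite tnthS; congr tnth; exact: val_inj. Qed.

Lemma lebesgue_tuple_box n (a b : R) : a <= b ->
  mu n [set t | forall i, `[a, b]%classic (tnth t i)] = ((b - a) ^+ n)%:E.
Proof.
move=> ab; elim: n => [|n IH].
  have -> : [set t : tup 0 | forall i, `[a, b]%classic (tnth t i)] = setT.
    by apply/seteqP; split=> // t _ [].
  by rewrite /= diracT expr0.
transitivity ((leb \x mu n) (`[a, b] `*` [set t | forall i, `[a, b]%classic (tnth t
  i)]))%E.
  congr ((_ \x _)%E _); apply/seteqP; split=> -[x t] /=.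
    move=> h; split; first by have := h ord0; rewrite tnth0.
    by move=> i; have := h (lift ord0 i); rewrite tnth_tuple_consS.
  move=> [hx ht] i; case: (unliftP ord0 i) => [j ->|->]; last by rewrite tnth0.
  by rewrite tnth_tuple_consS; exact: ht.
rewrite product_measure1E//;
  last by apply: (@measurable_tuple_forall _ (fun=> `[a, b]%classic)).
rewrite exprS EFinM; congr (_ * _)%E; last exact: IH.
transitivity (leb `[a, b]%classic) => //; rewrite lebesgue_measure_itv/= lte_fin.
by case: ltgtP ab => // -> _; rewrite subrr.
Qed.

Lemma volume_fin_num n (A : set 'cV[R]_n) : compact A -> volume A \is a fin_num.
Proof.
move=> cA; rewrite ge0_fin_numE ?volume_ge0//.
have [M [_ /(_ (`|M| + 1))]] := compact_bounded cA.
rewrite (le_lt_trans (ler_norm _)) ?ltrDl// => /(_ isT) AM.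
apply: (@le_lt_trans _ _ (mu n [set t | forall i, `[- (`|M| + 1), (`|M| + 1)]%classic
  (tnth t i)])).
  apply: le_measure; rewrite ?inE; first exact: compact_measurable_tuple.
    by apply: (@measurable_tuple_forall _ (fun=> `[- (`|M| + 1), (`|M| + 1)]%classic)).
  move=> t /= At i; rewrite in_itv/= -ler_norml.
  apply: le_trans (AM _ At); rewrite [leRHS]mx_normrE.
  have := le_bigmax 0 (fun k : 'I_n * 'I_1 => `|(vec_of_tuple t) k.1 k.2|) (i, 0).
  by rewrite /= mxE.
by rewrite lebesgue_tuple_box ?ltry//; have := normr_ge0 M; lra.
Qed.

End volume_theory.

(** * Adding a segment *)

Section linear_geometry.
Context (R : realType).

(** Convexity with a real parameter and plain membership, which suits linear arithmetic;
    [convex_setE] translates it. *)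
Definition cvx n (A : set 'cV[R]_n) :=
  forall x y (t : R), 0 <= t <= 1 -> A x -> A y -> A (t *: x + (1 - t) *: y).

Definition limg m n (g : 'M[R]_(m, n)) (A : set 'cV[R]_n) : set 'cV[R]_m :=
  [set g *m x | x in A].

Definition add_segment n (v : 'cV[R]_n) (A : set 'cV[R]_n) : set 'cV[R]_n :=
  [set x + t *: v | x in A & t in `[(-1 : R), 1]%classic].

(** The sum of [A] and [rho] times the zonotope generated by [s], built one segment at a time to fit
    induction on [s]. *)
Definition add_zonotope n (rho : R) (s : seq 'cV[R]_n) (A : set 'cV[R]_n) :=
  foldr (fun w => add_segment (rho *: w)) A s.

Lemma limg_comp m n p (g : 'M[R]_(m, n)) (h : 'M[R]_(n, p)) A :
  limg g (limg h A) = limg (g *m h) A.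
Proof.
apply/seteqP; split=> x /=.
  by move=> [_ [y Ay <-] <-]; exists y => //; rewrite mulmxA.
by move=> [y Ay <-]; exists (h *m y); [exists y|rewrite mulmxA].
Qed.

Lemma limg_compact m n (g : 'M[R]_(m, n)) A : compact A -> compact (limg g A).
Proof.
move=> cA; rewrite (_ : limg g A = [set g *m x + 0 | x in A]).
  exact: affine_image_compact.
by apply/seteqP; split=> x /= [y Ay <-]; exists y => //; rewrite addr0.
Qed.

Lemma limg_cvx m n (g : 'M[R]_(m, n)) A : cvx A -> cvx (limg g A).
Proof.
move=> cA _ _ t t01 [x Ax <-] [y Ay <-].
by exists (t *: x + (1 - t) *: y); [exact: cA|rewrite mulmxDr !scalemxAr].
Qed.

Lemma limgS m n (g : 'M[R]_(m, n)) A B : A `<=` B -> limg g A `<=` limg g B.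
Proof. by move=> AB _ [x Ax <-]; exists x => //; exact: AB. Qed.

Lemma limg_add_segment m n (g : 'M[R]_(m, n)) v A :
  limg g (add_segment v A) = add_segment (g *m v) (limg g A).
Proof.
apply/seteqP; split=> x /=.
  move=> [_ [y Ay [t t1 <-]] <-]; exists (g *m y); first by exists y.
  by exists t => //; rewrite mulmxDr scalemxAr.
move=> [_ [y Ay <-] [t t1 <-]]; exists (y + t *: v).
  by exists y => //; exists t.
by rewrite mulmxDr scalemxAr.
Qed.

Lemma limg_add_zonotope m n (g : 'M[R]_(m, n)) rho s A :
  limg g (add_zonotope rho s A) = add_zonotope rho (map (mulmx g) s) (limg g A).
Proof. by elim: s => //= w s IH; rewrite limg_add_segment IH scalemxAr. Qed.

Lemma add_segment_compact n (v : 'cV[R]_n) A : compact A -> compact (add_segment v A).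
Proof.
move=> cA.
rewrite (_ : add_segment v A =
    (fun p : 'cV[R]_n * R^o => p.1 + p.2 *: v) @` (A `*` `[(-1 : R), 1]%classic)).
  apply: continuous_compact.
    apply: continuous_subspaceT => p.
    apply: cvgD; first exact: cvg_fst.
    by apply: cvgZr_tmp; exact: cvg_snd.
  by apply: compact_setX => //; exact: segment_compact.
apply/seteqP; split=> x /=.
  by move=> [y Ay [t t1 <-]]; exists (y, t).
by move=> [[y t] /= [Ay t1] <-]; exists y => //; exists t.
Qed.

Lemma add_segment_cvx n (v : 'cV[R]_n) A : cvx A -> cvx (add_segment v A).
Proof.
move=> cA _ _ t t01 [x Ax [a a1 <-]] [y Ay [b b1 <-]].
exists (t *: x + (1 - t) *: y); first exact: cA.
exists (t * a + (1 - t) * b).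
  move: a1 b1 t01; rewrite /= !in_itv/= => /andP[a1 a2] /andP[b1 b2] /andP[t0 t1].
  by apply/andP; split; nra.
by rewrite [X in _ + X]scalerDl !scalerDr !scalerA addrACA.
Qed.

Lemma add_zonotope_compact n rho (s : seq 'cV[R]_n) A :
  compact A -> compact (add_zonotope rho s A).
Proof. by move=> cA; elim: s => //= w s; exact: add_segment_compact. Qed.

Lemma add_zonotope_cvx n rho (s : seq 'cV[R]_n) A : cvx A -> cvx (add_zonotope rho s A).
Proof. by move=> cA; elim: s => //= w s; exact: add_segment_cvx. Qed.

Lemma add_segment0 n (A : set 'cV[R]_n) : add_segment 0 A = A.
Proof.
apply/seteqP; split=> x /=; first by move=> [y Ay [t _ <-]]; rewrite scaler0 addr0.
move=> Ax; exists x => //; exists 0; last by rewrite scaler0 addr0.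
by rewrite /= in_itv/= lerN10 ler01.
Qed.

Definition dotv n (x y : 'cV[R]_n) : R := \sum_i x i 0 * y i 0.

Lemma dotvE n (x y : 'cV[R]_n) : dotv x y = (x^T *m y) 0 0.
Proof. by rewrite mxE; apply: eq_bigr => i _; rewrite mxE. Qed.

Lemma dotvC n (x y : 'cV[R]_n) : dotv x y = dotv y x.
Proof. by apply: eq_bigr => i _; rewrite mulrC. Qed.

Lemma dotvDr n (x y z : 'cV[R]_n) : dotv x (y + z) = dotv x y + dotv x z.
Proof. by rewrite -big_split; apply: eq_bigr => i _; rewrite mxE mulrDr. Qed.

Lemma dotvZr n a (x y : 'cV[R]_n) : dotv x (a *: y) = a * dotv x y.
Proof. by rewrite mulr_sumr; apply: eq_bigr => i _; rewrite mxE mulrCA. Qed.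

Lemma dotvBr n (x y z : 'cV[R]_n) : dotv x (y - z) = dotv x y - dotv x z.
Proof. by rewrite -scaleN1r dotvDr dotvZr mulN1r. Qed.

Lemma dotvBl n (x y z : 'cV[R]_n) : dotv (x - y) z = dotv x z - dotv y z.
Proof. by rewrite dotvC dotvBr dotvC (dotvC z y). Qed.

Lemma dotv0r n (x : 'cV[R]_n) : dotv x 0 = 0.
Proof. by rewrite -(scale0r 0) dotvZr mul0r. Qed.

Lemma dotvNl n (x y : 'cV[R]_n) : dotv (- x) y = - dotv x y.
Proof. by rewrite -[- x]sub0r dotvBl dotvC dotv0r sub0r. Qed.

Lemma dotv_delta n (x : 'cV[R]_n) i : dotv (delta_mx i 0) x = x i 0.
Proof.
rewrite /dotv (bigD1 i)//= big1 ?addr0 ?mxE ?eqxx ?mul1r// => j ji.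
by rewrite mxE (negbTE ji) mul0r.
Qed.

Lemma dotvv n (x : 'cV[R]_n) : dotv x x = enorm x ^+ 2.
Proof. by rewrite enorm_sqr; apply: eq_bigr => i _; rewrite expr2. Qed.

Lemma dotv_mulmxr n m (g : 'M[R]_(m, n)) x y : dotv x (g *m y) = dotv (g^T *m x) y.
Proof. by rewrite !dotvE trmx_mul trmxK mulmxA. Qed.

Lemma enorm_eq0 n (x : 'cV[R]_n) : (enorm x == 0) = (x == 0).
Proof.
apply/eqP/eqP => [x0|->]; last exact: enorm0.
by apply/eqP; rewrite -normr_le0 (le_trans (normr_le_enorm x)) ?x0.
Qed.

Lemma dotvv_gt0 n (x : 'cV[R]_n) : x != 0 -> 0 < dotv x x.
Proof.
by move=> x0; rewrite dotvv exprn_gt0// lt_neqAle eq_sym enorm_eq0 x0 enorm_ge0.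
Qed.

Definition orthogonalmx n (g : 'M[R]_n) := g^T *m g = 1%:M.

Lemma orthogonalmx_unit n (g : 'M[R]_n) : orthogonalmx g -> g \in unitmx.
Proof. by move=> /mulmx1_unit[]. Qed.

Lemma orthogonalmx_det n (g : 'M[R]_n) : orthogonalmx g -> `|\det g| = 1.
Proof.
move=> /(congr1 determinant); rewrite det_mulmx det_tr det1 => /eqP.
rewrite -expr2 sqrf_eq1 => /orP[] /eqP ->; by rewrite ?normrN normr1.
Qed.

Lemma orthogonalmx_dotv n (g : 'M[R]_n) x y : orthogonalmx g ->
  dotv (g *m x) (g *m y) = dotv x y.
Proof. by move=> gO; rewrite dotv_mulmxr mulmxA gO mul1mx. Qed.

Lemma orthogonalmx_enorm n (g : 'M[R]_n) x : orthogonalmx g -> enorm (g *m x) = enorm x.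
Proof.
move=> gO; apply/eqP; rewrite -(@eqrXn2 _ 2) ?enorm_ge0//.
by rewrite -!dotvv orthogonalmx_dotv.
Qed.

(* The reflection exchanging [w] and the point of the first axis with the same norm. *)
Lemma householder n (w : 'cV[R]_n.+1) :
  exists2 g : 'M[R]_n.+1, orthogonalmx g & g *m w = enorm w *: delta_mx 0 0.
Proof.
pose u : 'cV[R]_n.+1 := w - enorm w *: delta_mx 0 0.
have [u0|u0] := eqVneq u 0.
  exists 1%:M; first by rewrite /orthogonalmx trmx1 mulmx1.
  by rewrite mul1mx; apply/eqP; rewrite -subr_eq0 -/u u0.
have q0 := dotvv_gt0 u0; set q := dotv u u in q0.
have dotE (x : 'cV[R]_n.+1) : u^T *m x = (dotv u x)%:M.
  by rewrite [LHS]mx11_scalar dotvE.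
have gx (x : 'cV[R]_n.+1) : (1%:M - (2 / q) *: (u *m u^T)) *m x =
    x - (2 / q * dotv u x) *: u.
  by rewrite mulmxBl mul1mx -scalemxAl -mulmxA dotE mul_mx_scalar scalerA.
exists (1%:M - (2 / q) *: (u *m u^T)).
  rewrite /orthogonalmx [X in X *m _](_ : _ = 1%:M - (2 / q) *: (u *m u^T)); last first.
    by rewrite raddfB/= trmx1 linearZ/= trmx_mul trmxK.
  rewrite mulmxBr mulmx1 -scalemxAr mulmxA gx -/q.
  have -> : u - (2 / q * q) *: u = - u.
    by rewrite divfK ?gt_eqF// scaler_nat mulr2n opprD addrA subrr sub0r.
  by rewrite mulNmx scalerN opprK subrK.
have dw : dotv u w = enorm w ^+ 2 - enorm w * w 0 0.
  by rewrite /u dotvBl dotvv (dotvC (_ *: _)) dotvZr dotvC dotv_delta.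
have de : dotv u (delta_mx 0 0) = w 0 0 - enorm w.
  by rewrite dotvC dotv_delta !mxE !eqxx mulr1.
(* Equality of the two norms gives this, and it makes the reflection subtract exactly [u] from
   [w]. *)
have qE : q = 2 * dotv u w.
  by rewrite /q {2}/u dotvBr dotvZr dw de; ring.
rewrite gx -[2 / q * _]mulrAC -qE divff ?gt_eqF// scale1r /u opprB addrC subrK.
by [].
Qed.

Local Notation leb := (@lebesgue_measure R).

(** [S] is an interval [p, q] and becomes [p - r, q + r]. An empty [S] would gain nothing, which is
    how the projection enters [volume_add_segment_axis]. *)
Lemma lebesgue_thicken (S : set R) (r : R) : 0 <= r -> compact S -> S !=set0 ->
  (forall x y t, 0 <= t <= 1 -> S x -> S y -> S (t * x + (1 - t) * y)) ->
  leb [set x + t * r | x in S & t in `[(-1 : R), 1]%classic] = (leb S + (2 * r)%:E)%E.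
Proof.
move=> r0 cS S0 vS.
have cid : {within S, continuous (@id R)} by apply: continuous_subspaceT => x;
  exact: cvg_id.
have [p /set_mem Sp pmin] := compact_EVT_min S0 cS cid.
have [q /set_mem Sq qmax] := compact_EVT_max S0 cS cid.
have pq : p <= q by apply: pmin; exact/mem_set.
have SE : S = `[p, q]%classic.
  apply/seteqP; split=> x /=; rewrite in_itv/=.
    by move=> Sx; rewrite pmin ?qmax//; exact/mem_set.
  move=> /andP[px xq]; have [pq'|pq'] := eqVneq p q.
    by rewrite (_ : x = p)//; apply/eqP; rewrite eq_le px pq' xq.
  have d0 : 0 < q - p by rewrite subr_gt0 lt_neqAle pq'.
  rewrite (_ : x = (q - x) / (q - p) * p + (1 - (q - x) / (q - p)) * q).
    apply: vS => //; apply/andP; split; first by rewrite divr_ge0// ?subr_ge0// ltW.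
    by rewrite ler_pdivrMr// mul1r lerD2l lerN2.
  by field; rewrite gt_eqF.
rewrite (_ : [set _ | _ in _ & _ in _] = `[p - r, q + r]%classic).
  rewrite SE !lebesgue_measure_itv/= !lte_fin.
  case: (ltgtP p q) pq => [pq _|//|-> _].
    rewrite ifT; last lra.
    by rewrite -!EFinD; congr (_%:E); ring.
  rewrite add0e; case: ltP => h.
    by rewrite -!EFinD; congr (_%:E); ring.
  by congr (_%:E); lra.
rewrite SE; apply/seteqP; split=> z /=.
  move=> [x]; rewrite /= in_itv/= => /andP[px xq] [t];
    rewrite /= in_itv/= => /andP[t1 t2] <-.
  by rewrite in_itv/=; apply/andP; split; nra.
rewrite in_itv/= => /andP[pz zq].
have [zp|zp] := ltP z p.
  exists p; first by rewrite /= in_itv/= lexx.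
  have rp : 0 < r by lra.
  exists ((z - p) / r); last by field; rewrite gt_eqF.
  by rewrite /= in_itv/= ler_pdivrMr// ler_pdivlMr//; apply/andP; split; lra.
have [qz|qz] := ltP q z.
  exists q; first by rewrite /= in_itv/= lexx andbT.
  have rp : 0 < r by lra.
  exists ((z - q) / r); last by field; rewrite gt_eqF.
  by rewrite /= in_itv/= ler_pdivrMr// ler_pdivlMr//; apply/andP; split; lra.
exists z; first by rewrite /= in_itv/= zp.
by exists 0; rewrite ?mul0r ?addr0//= in_itv/= lerN10 ler01.
Qed.

End linear_geometry.

(** * Volume of the sum of a convex body and a scaled zonotope *)

Section zonotope_polynomial.
Context (R : realType).
Local Notation tup n := (n.-tuple (measurableTypeR R)).
Local Notation leb := (@lebesgue_measure R).
Local Notation mu n := (lebesgue_tuple R n).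

Definition tailmx n : 'M[R]_(n, 1 + n) := row_mx 0 1%:M.

Lemma tailmx_col n (x : 'cV[R]_1) (v : 'cV[R]_n) : tailmx n *m col_mx x v = v.
Proof. by rewrite mul_row_col mul0mx mul1mx add0r. Qed.

Lemma fiber_compact n (A : set 'cV[R]_(1 + n)) (v : 'cV[R]_n) : compact A ->
  compact [set x : R | A (col_mx x%:M v)].
Proof.
move=> cA.
have coord00 : continuous (fun y : 'cV[R]_(1 + n) => y 0 0) by exact: coord_continuous.
have cl : closed [set y : 'cV[R]_(1 + n) | tailmx n *m y = v].
  rewrite (_ : [set _ | _] = (fun y => tailmx n *m y + 0) @^-1` [set v]).
    apply: closed_comp; first by move=> y _; exact: affine_continuous.
    apply: compact_closed; first exact: norm_hausdorff.
    exact: compact_set1.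
  by apply/seteqP; split=> y /=; rewrite addr0.
rewrite (_ : [set x | _] =
    (fun y : 'cV[R]_(1 + n) => y 0 0) @` (A `&` [set y | tailmx n *m y = v])).
  apply: continuous_compact; first exact: continuous_subspaceT.
  exact: compact_closedI.
have e0 : (0 : 'I_(1 + n)) = lshift n 0 by exact: val_inj.
apply/seteqP; split=> x /=.
  move=> Ax; exists (col_mx x%:M v); last by rewrite e0 col_mxEu mxE eqxx.
  by split => //; exact: tailmx_col.
move=> [y [Ay yv] <-]; rewrite (_ : col_mx _ _ = y)//.
rewrite -[RHS]vsubmxK; congr col_mx; last by rewrite -yv -{1}[y]vsubmxK tailmx_col.
by rewrite [RHS]mx11_scalar mxE -e0.
Qed.

Lemma scale_delta_axis n (r : R) :
  r *: delta_mx 0 0 = col_mx r%:M 0 :> 'cV[R]_(1 + n).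
Proof.
apply/matrixP => i j; rewrite (ord1 j) !mxE; case: splitP => k.
  by rewrite (ord1 k) => /= i0; rewrite !mxE/= -val_eqE/= i0 eqxx mulr1.
by move=> ik; rewrite !mxE -val_eqE/= ik mulr0.
Qed.

(** Each nonempty fibre along the first axis grows by 2r, and the fibres are nonempty exactly over
    the projection of [A]. *)
Lemma volume_add_segment_axis n (r : R) (A : set 'cV[R]_(1 + n)) :
  0 <= r -> compact A -> cvx A ->
  volume (add_segment (col_mx r%:M 0) A) =
  (volume A + (2 * r)%:E * volume (limg (tailmx n) A))%E.
Proof.
move=> r0 cA vA.
have mA := compact_measurable_tuple cA.
have mB := compact_measurable_tuple (add_segment_compact (v := col_mx r%:M 0) cA).
have mT := compact_measurable_tuple (limg_compact (g := tailmx n) cA).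
rewrite !volumeE !(@lebesgue_tuple_ysection R n)//.
transitivity (\int[mu n]_t (leb [set x | A (vec_of_tuple (tuple_cons (x, t)))] +
   (2 * r)%:E * (\1_[set t : tup n | limg (tailmx n) A (vec_of_tuple t)] t)%:E))%E;
     last first.
  rewrite ge0_integralD//; last 3 first.
  - exact: (measurable_lebesgue_ysection mA).
  - by move=> t _; rewrite mule_ge0// lee_fin ?mulr_ge0.
  - apply: measurable_funeM; apply/measurable_EFinP.
    exact: measurable_indic.
  rewrite ge0_integralZl//; last 2 first.
  - apply/measurable_EFinP; exact: measurable_indic.
  - by rewrite lee_fin mulr_ge0.
  by rewrite integral_indic// setIT.
apply: eq_integral => t _; rewrite /=.
set v := vec_of_tuple t.
have tailE : limg (tailmx n) A v <-> exists x : R, A (col_mx x%:M v).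
  split=> [[y Ay yv]|[x Ax]]; last by exists (col_mx x%:M v); rewrite ?tailmx_col.
  exists (usubmx y 0 0); rewrite -mx11_scalar -yv -{2}[y]vsubmxK tailmx_col.
  by rewrite vsubmxK.
have segE (x : R) : add_segment (col_mx r%:M 0) A (col_mx x%:M v) <->
    exists2 y : R, A (col_mx y%:M v) & exists2 s, -1 <= s <= 1 & x = y + s * r.
  split.
    move=> [y Ay [s]]; rewrite /= in_itv/= => s1.
    rewrite -(vsubmxK (y : 'cV[R]_(1 + n))) scale_col_mx scaler0 add_col_mx addr0 =>
      /eq_col_mx[xE vE].
    exists (usubmx y 0 0); first by rewrite -mx11_scalar -vE vsubmxK.
    exists s => //; move/matrixP : xE => /(_ 0 0).
    by rewrite !mxE eqxx !mulr1n => <-.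
  move=> [y Ay [s s1 ->]]; exists (col_mx y%:M v) => //; exists s => //.
  by rewrite scale_col_mx scaler0 add_col_mx addr0 scale_scalar_mx -raddfD.
have consE (B : set 'cV[R]_(1 + n)) :
    [set x : R | B (vec_of_tuple (tuple_cons (x, t)))] = [set x : R | B (col_mx x%:M
      v)].
  by apply: eq_set => x; rewrite vec_of_tuple_cons.
rewrite !consE.
have [[x0 Ax0]|nA] := pselect (exists x : R, A (col_mx x%:M v)).
  rewrite indicE mem_set/=; last by apply/tailE; exists x0.
  rewrite mule1 -lebesgue_thicken//; last 3 first.
  - exact: fiber_compact.
  - by exists x0.
  - move=> x y s s01 /= Ax Ay.
    have := vA _ _ _ s01 Ax Ay.
    by rewrite !scale_col_mx add_col_mx -scalerDl [s + _]addrC subrK scale1r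
      !scale_scalar_mx -raddfD.
  congr (leb _); apply/seteqP; split=> x /=.
    by move/segE => [y Ay [s s1 ->]]; exists y => //; exists s.
  move=> [y Ay [s s1 <-]]; apply/segE; exists y => //; exists s => //.
rewrite indicE memNset/=; last by move/tailE.
rewrite mule0 adde0; congr (leb _); apply/seteqP; split=> x /=.
  by move/segE => [y Ay _]; case: nA; exists y.
by move=> Ax; case: nA; exists x.
Qed.

Lemma volume_limg_orthogonal n (g : 'M[R]_n) A : orthogonalmx g -> compact A ->
  volume (limg g A) = volume A.
Proof.
move=> gO cA.
have := volume_affine 0 (orthogonalmx_unit gO) cA.
rewrite orthogonalmx_det// mul1e => <-.
by congr volume; apply/seteqP; split=> x /= [y Ay <-]; exists y; rewrite ?addr0.
Qed.

(** The coefficients are functions of the body, so that two bodies can be compared. The induction is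
    on the size of [s] with [n] and [s] general, because the projection lowers the dimension and
    changes the vectors. *)
Lemma zonotope_polynomial n (s : seq 'cV[R]_n) :
  exists coef : set 'cV[R]_n -> nat -> R,
  [/\ forall A, compact A -> cvx A -> forall i, 0 <= coef A i,
      forall A B, compact A -> cvx A -> compact B -> cvx B -> A `<=` B ->
        forall i, coef A i <= coef B i &
      forall A rho, compact A -> cvx A -> 0 <= rho ->
        volume (add_zonotope rho s A) = (\sum_(i < n.+1) coef A i * rho ^+ i)%:E].
Proof.
move: {2}(size s) (erefl (size s)) => k.
elim: k n s => [|k IH] n [|w s]// => [_|[sk]].
  exists (fun A i => if i is 0 then fine (volume A) else 0); split.
  - by move=> A cA vA [|i]//; rewrite fine_ge0// volume_ge0.
  - move=> A B cA vA cB vB AB [|i]//; apply: fine_le; rewrite ?volume_fin_num//.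
    exact: le_volume.
  - move=> A rho cA vA rho0; rewrite big_ord_recl big1/=; last by move=> i _;
    rewrite mul0r.
    by rewrite expr0 mulr1 addr0 fineK// volume_fin_num.
have [c1 [c1_ge0 c1_le c1E]] := IH _ s sk.
have [w0|w0] := eqVneq w 0.
  exists c1; split=> // A rho cA vA rho0.
  by rewrite /= w0 scaler0 add_segment0; exact: c1E.
case: n => [|n] in w s sk w0 c1 c1_ge0 c1_le c1E *.
  by move: w0; rewrite [w]flatmx0 eqxx.
have [g gO gw] := householder w.
pose P := tailmx n *m g.
have [c2 [c2_ge0 c2_le c2E]] := IH _ (map (mulmx P) s) (etrans (size_map _ _) sk).
have w2 : 0 <= 2 * enorm w by rewrite mulr_ge0// enorm_ge0.
(* The segment from [- rho w] to [rho w] adds 2 rho |w| times the volume of the projected sum; the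
   factor [rho] shifts the coefficients [c2] by one degree. *)
exists (fun A i => c1 A i + (if i is i'.+1 then 2 * enorm w * c2 (limg P A) i' else 0));
  split.
- move=> A cA vA i; rewrite addr_ge0 ?c1_ge0//; case: i => // i.
  by rewrite mulr_ge0// c2_ge0//; [exact: limg_compact|exact: limg_cvx].
- move=> A B cA vA cB vB AB i; apply: lerD; first exact: c1_le.
  case: i => // i; rewrite ler_wpM2l// c2_le//;
    by [exact: limg_compact|exact: limg_cvx|exact: limgS].
move=> A rho cA vA rho0 /=.
have cZ := add_zonotope_compact (rho := rho) (s := s) cA.
have vZ := add_zonotope_cvx (rho := rho) (s := s) vA.
rewrite -(volume_limg_orthogonal gO); last exact: add_segment_compact.
rewrite limg_add_segment -scalemxAr gw scalerA scale_delta_axis volume_add_segment_axis;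
  last 3 first.
- by rewrite mulr_ge0// enorm_ge0.
- exact: limg_compact.
- exact: limg_cvx.
rewrite volume_limg_orthogonal// c1E// limg_comp -/P limg_add_zonotope.
rewrite c2E//; [|exact: limg_compact|exact: limg_cvx].
rewrite -EFinM -EFinD; congr (_%:E).
rewrite [RHS](eq_bigr (fun i : 'I_n.+2 => c1 A i * rho ^+ i +
  (if (i : nat) is i'.+1 then 2 * enorm w * c2 (limg P A) i' else 0) * rho ^+ i));
    last first.
  by move=> i _; rewrite mulrDl.
rewrite big_split/=; congr (_ + _).
rewrite [RHS]big_ord_recl/= mul0r add0r mulr_sumr.
apply: eq_bigr => i _; rewrite exprS; ring.
Qed.

End zonotope_polynomial.

(** * The ball as a limit of zonotopes *)

Section euclidean_topology.
Context (R : realType).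

Lemma enorm_continuous n : continuous (@enorm R n).
Proof.
move=> x; apply/(@cvgrPdist_le _ _ _ (nbhs x)) => e e0.
near=> y.
have xy : n%:R * `|x - y| <= e.
  apply: (@le_trans _ _ (n.+1%:R * `|x - y|)); first by rewrite ler_wpM2r// ler_nat.
  rewrite mulrC -ler_pdivlMr ?ltr0n//.
  near: y; apply/nbhs_ballP; exists (e / n.+1%:R) => /=;
    first by rewrite divr_gt0// ltr0n.
  by move=> y; rewrite -ball_normE /ball_/= => /ltW.
apply: le_trans xy; apply: le_trans (enorm_le_normr _).
have h1 := ler_enormD (x - y) y; have h2 := ler_enormD (y - x) x.
move: h1 h2; rewrite !subrK -(enormN (y - x)) opprB.
by rewrite ler_norml => h1 h2; apply/andP; split; lra.
Unshelve. all: by end_near. Qed.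

Lemma trmx_continuous m n : continuous (@trmx R m n).
Proof.
move=> x; apply/(@cvgrPdist_le _ _ _ (nbhs x)) => e e0.
near=> y.
have xy : `|x - y| <= e.
  near: y; apply/nbhs_ballP; exists e => //=.
  by move=> y; rewrite -ball_normE /ball_/= => /ltW.
rewrite -raddfB/= [leLHS]mx_normrE; apply: bigmax_le; first exact: ltW.
move=> [i j] _ /=; apply: le_trans xy; rewrite mxE [leRHS]mx_normrE.
exact: (le_bigmax _ (fun k => `|(x - y) k.1 k.2|) (j, i)).
Unshelve. all: by end_near. Qed.

Lemma closed_enorm_bounded_compact n (A : set 'cV[R]_n) (M : R) :
  closed A -> (forall x, A x -> enorm x <= M) -> compact A.
Proof.
move=> cA AM.
(* The enclosing cube is compact as a set of row vectors, and transposition carries it to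
   columns. *)
pose box := [set v : 'rV[R]_n | forall i, `[(- M), M]%classic (v ord0 i)].
have cbox : compact ((@trmx R 1 n) @` box).
  apply: continuous_compact; first by apply: continuous_subspaceT;
    exact: trmx_continuous.
  by apply: (@rV_compact R n (fun=> `[(- M), M]%classic)) => i; exact: segment_compact.
apply: (subclosed_compact cA cbox) => x Ax; exists x^T; last exact: trmxK.
move=> i; rewrite /= in_itv/= -ler_norml mxE (le_trans (coord_le_enorm x i))//.
exact: AM.
Qed.

Lemma enorm_ball_compact n (r : R) : compact [set x : 'cV[R]_n | enorm x <= r].
Proof.
apply: (@closed_enorm_bounded_compact _ _ r) => //.
rewrite (_ : [set _ | _] = (@enorm R n) @^-1` [set y | y <= r]).
  apply: closed_comp; first by move=> x _; exact: enorm_continuous.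
  exact: closed_le.
by [].
Qed.

Lemma dotv_continuous n (u : 'cV[R]_n) : continuous (dotv u).
Proof.
have -> : dotv u = (fun y : 'cV[R]_1 => y 0 0) \o (fun x => u^T *m x + 0).
  by apply/funext => x /=; rewrite addr0 dotvE.
move=> x; apply: continuous_comp; first exact: affine_continuous.
exact: coord_continuous.
Qed.

Lemma dotv_subZ n (x y : 'cV[R]_n) (t : R) :
  dotv (x - t *: y) (x - t *: y) = dotv x x - 2 * t * dotv x y + t ^+ 2 * dotv y y.
Proof. by rewrite dotvBr !dotvBl (dotvC (t *: y)) !dotvZr (dotvC (t *: y)) dotvZr;
  ring. Qed.

(* The point of [K] nearest to [x] would be separated from [x] by the
   difference of the two points. *)
Lemma support_sub n (K : set 'cV[R]_n) x : compact K -> cvx K ->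
  (forall u, exists2 y, K y & dotv u x <= dotv u y) -> K x.
Proof.
move=> cK vK h.
have K0 : K !=set0 by have [y Ky _] := h 0; exists y.
have cf : {within K, continuous (fun y => enorm (x - y))}.
  apply: continuous_subspaceT => y.
  apply: (cvg_comp (fun y => x - y) (@enorm R n) _ (@enorm_continuous n (x - y))).
  rewrite (_ : (fun y => x - y) = (fun y => (-1)%:M *m y + x)).
    rewrite (_ : x - y = (-1)%:M *m y + x); first exact: affine_continuous.
    by rewrite mul_scalar_mx scaleN1r addrC.
  by apply/funext => z; rewrite mul_scalar_mx scaleN1r addrC.
have [y0 /set_mem Ky0 y0min] := compact_EVT_min K0 cK cf.
have [u0|u0] := eqVneq (x - y0) 0.
  by move/eqP: u0; rewrite subr_eq0 => /eqP ->.
exfalso; set u := x - y0 in u0 y0min.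
have q0 := dotvv_gt0 u0; set q := dotv u u in q0.
have [y Ky uy] := h u; pose d := y - y0.
have ud : q <= dotv u d by rewrite /q {2}/u /d !dotvBr lerD2r.
have D0 : 0 <= dotv d d by rewrite dotvv sqr_ge0.
set D := dotv d d in D0.
(* With <u, d> >= q, the squared distance drops by at least tq + t(q - tD); this [t] is positive, at
   most 1, and satisfies tD < q. *)
pose t := q / (q + D).
have t01 : 0 <= t <= 1.
  rewrite /t; apply/andP; split; first by rewrite divr_ge0 ?addr_ge0// ltW.
  by rewrite ler_pdivrMr ?mul1r ?lerDl// ltr_wpDr.
have := y0min (t *: y + (1 - t) *: y0) (mem_set (vK _ _ _ t01 Ky Ky0)).
have -> : x - (t *: y + (1 - t) *: y0) = u - t *: d.
  by apply/matrixP => i j; rewrite !mxE; ring.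
rewrite -ler_sqr ?nnegrE ?enorm_ge0// -!dotvv -/q.
rewrite dotv_subZ -/q -/D.
have tD : t * D < q.
  rewrite /t mulrAC ltr_pdivrMr ?ltr_wpDr// mulrDr ltrDr mulr_gt0//.
have t0 : 0 < t by rewrite /t divr_gt0// ltr_wpDr.
have h1 : 0 <= t * (dotv u d - q) by rewrite mulr_ge0 ?subr_ge0// ltW.
have h2 : 0 < t * (q - t * D) by rewrite mulr_gt0// subr_gt0.
have h3 : 0 < t * q by rewrite mulr_gt0.
by move=> h4; lra.
Qed.

End euclidean_topology.

(** * Zonotopes approximating the Euclidean ball *)

Section ball_zonotope.
Context (R : realType) (n : nat).
Local Notation tup := (n.+1.-tuple (measurableTypeR R)).
Local Notation mu := (lebesgue_tuple R n.+1).
Local Notation vec := (@vec_of_tuple R n.+1).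
Local Notation axis := (delta_mx 0%R 0%R : 'cV[R]_n.+1).

Let B : set tup := [set t | enorm (vec t) <= 1].

Let mB : measurable B.
Proof. exact: compact_measurable_tuple (@enorm_ball_compact R n.+1 1). Qed.

Let muB_fin : mu B \is a fin_num.
Proof. exact: volume_fin_num (@enorm_ball_compact R n.+1 1). Qed.

Lemma measurable_dotv_tuple (u : 'cV[R]_n.+1) (D : set tup) :
  measurable_fun D (fun t => (`|dotv u (vec t)|)%:E).
Proof.
apply/measurable_funTS/measurable_EFinP; apply: measurableT_comp => //.
apply: measurable_sum => i; apply: measurable_funM => //.
rewrite (_ : (fun _ => _) = fun t : tup => tnth t i); first exact: measurable_tnth.
by apply/funext => t; rewrite mxE.
Qed.

(** The support function of the zonoid obtained by integrating the segments [-x, x] over the ball;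
    by rotation invariance this zonoid is itself a ball. *)
Definition ball_moment (u : 'cV[R]_n.+1) : \bar R :=
  (\int[mu]_(t in B) (`|dotv u (vec t)|)%:E)%E.

Lemma ball_moment_orthogonal (g : 'M[R]_n.+1) u : orthogonalmx g ->
  ball_moment (g *m u) = ball_moment u.
Proof.
move=> gO.
have mg := measurable_affine_tuple g (0 : 'cV[R]_n.+1).
rewrite /ball_moment.
rewrite (@eq_measure_integral _ _ _ _ (pushforward mu (affine_tuple g 0))); last first.
  move=> A mA _; have E := affine_scales_unit 0 (orthogonalmx_unit gO) mA.
  by rewrite orthogonalmx_det// mul1e in E; exact/esym/E.
rewrite ge0_integral_pushforward//; last exact: measurable_dotv_tuple.
rewrite (_ : _ @^-1` B = B).
  apply: eq_integral => t _ /=.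
  by rewrite tuple_of_vecK addr0 orthogonalmx_dotv.
by apply: eq_set => t; rewrite /B/= tuple_of_vecK addr0 orthogonalmx_enorm.
Qed.

Lemma ball_momentZ (a : R) u : ball_moment (a *: u) = (`|a|%:E * ball_moment u)%E.
Proof.
rewrite /ball_moment -ge0_integralZl//; last exact: measurable_dotv_tuple.
by apply: eq_integral => t _; rewrite dotvC dotvZr normrM EFinM dotvC.
Qed.

Lemma ball_momentE u :
  ball_moment u = ((enorm u)%:E * ball_moment axis)%E.
Proof.
have [g gO gu] := householder u.
by rewrite -(ball_moment_orthogonal u gO) gu ball_momentZ ger0_norm ?enorm_ge0.
Qed.

Lemma dotv_le_enorm (u x : 'cV[R]_n.+1) : `|dotv u x| <= enorm u * enorm x.
Proof.
rewrite ler_norml cauchy_schwarz andbT lerNl -mulN1r -dotvZr scaleN1r.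
by rewrite -(enormN x) cauchy_schwarz.
Qed.

Lemma ball_moment_axis_fin : ball_moment axis \is a fin_num.
Proof.
rewrite ge0_fin_numE; last by apply: integral_ge0 => t _; rewrite lee_fin.
apply: (@le_lt_trans _ _ (\int[mu]_(t in B) (cst (enorm axis)%:E t))%E).
  apply: ge0_le_integral => //; first exact: measurable_dotv_tuple.
  move=> t Bt; rewrite lee_fin (le_trans (dotv_le_enorm _ _))//.
  by rewrite ler_piMr ?enorm_ge0.
rewrite integral_cst//.
by rewrite lte_mul_pinfty// ?lee_fin ?enorm_ge0// ltey_eq muB_fin.
Qed.

Lemma ball_moment_axis_gt0 : (0 < ball_moment axis)%E.
Proof.
(* The cube [a, 2a]^(n+1) lies in the ball since 2a = 1/(n+1), and the first coordinate is at least
   [a] on it. *)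
pose a : R := (2 * n.+1%:R)^-1.
have a0 : 0 < a by rewrite invr_gt0 mulr_gt0// ltr0n.
pose box := [set t : tup | forall i, `[a, 2 * a]%classic (tnth t i)].
have mbox : measurable box by apply: (@measurable_tuple_forall _ _ (fun=> `[a, 2 *
  a]%classic)).
have boxB : box `<=` B.
  move=> t bt; rewrite /B/= (le_trans (enorm_le_normr _))//.
  rewrite mulrC -ler_pdivlMr ?ltr0n// [leLHS]mx_normrE; apply: bigmax_le.
    by rewrite mul1r invr_ge0.
  move=> [i j] _ /=; rewrite mxE; have := bt i; rewrite /= in_itv/= => /andP[t1 t2].
  have t0 : 0 <= (tnth t i : R) by apply: le_trans t1; exact: ltW.
  rewrite ger0_norm//; apply: (le_trans t2).
  by rewrite /a mul1r invfM mulrA divff// mul1r.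
have boxE : mu box = ((2 * a - a) ^+ n.+1)%:E.
  by apply: lebesgue_tuple_box; rewrite ler_peMl ?ltW// ltr1n.
apply: (@lt_le_trans _ _ (a%:E * mu box)%E).
  by rewrite boxE -EFinM lte_fin mulr_gt0// exprn_gt0//; lra.
rewrite -integral_cst//.
apply: (@le_trans _ _ (\int[mu]_(t in box) (`|dotv axis (vec t)|)%:E)%E).
  apply: ge0_le_integral => //; first by move=> t _; rewrite lee_fin ltW.
    exact: measurable_dotv_tuple.
  move=> t bt; rewrite lee_fin dotv_delta mxE; have := bt 0.
  by rewrite /= in_itv/= => /andP[t1 _]; rewrite (le_trans t1)// ler_norm.
by apply: ge0_subset_integral => //; exact: measurable_dotv_tuple.
Qed.

Section discretization.
Context (N : nat).

(** Grid cells of side 1/(N+1). The affine map sends [-1, 1] onto [0, 2N+2], whose integer parts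
    take 2N+3 values, the last one only at the right end. *)
Let cell (k : {ffun 'I_n.+1 -> 'I_N.*2.+3}) : set tup :=
  [set t | forall i, ((fun x : measurableTypeR R => (N.+1%:R * x + N.+1%:R : R)) @^-1`
     `[(k i)%:R, (k i).+1%:R[%classic) (tnth t i)].

Let node (k : {ffun 'I_n.+1 -> 'I_N.*2.+3}) : 'cV[R]_n.+1 :=
  \col_i ((k i)%:R / N.+1%:R - 1).

Let mcell k : measurable (cell k).
Proof.
apply: (@measurable_tuple_forall _ _ (fun i => (fun x : measurableTypeR R => (N.+1%:R *
  x + N.+1%:R : R)) @^-1`
     `[(k i)%:R, (k i).+1%:R[%classic)) => i.
exact: measurable_preimage (measurable_affine _ _) (measurable_itv _).
Qed.

Let cell_inj k l t : cell k t -> cell l t -> k = l.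
Proof.
move=> kt lt; apply/ffunP => i; apply: val_inj => /=.
have := kt i; have := lt i; rewrite /= !in_itv/=.
set y := _ + _ => /andP[l1 l2] /andP[k1 k2].
apply/eqP; rewrite eqn_leq -ltnS -[(l i <= _)%N]ltnS -!(ltr_nat R).
by rewrite (le_lt_trans k1 l2) (le_lt_trans l1 k2).
Qed.

Let cell_cover t : B t -> exists k, cell k t.
Proof.
move=> Bt; have ti i : -1 <= (tnth t i : R) <= 1.
  by have := coord_le_enorm (vec t) i; rewrite mxE -ler_norml => /le_trans; exact.
pose y i : R := N.+1%:R * tnth t i + N.+1%:R.
have y0 i : 0 <= y i.
  by have /andP[t1 _] := ti i; have : 0 < N.+1%:R :> R by []; rewrite /y; nra.
have yi i : (Num.truncn (y i) < N.*2.+3)%N.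
  have /andP[_ t1] := ti i.
  rewrite -(ltr_nat R) (@le_lt_trans _ _ (y i)) ?truncn_le//.
  have N0 : 0 < N.+1%:R :> R by rewrite ltr0n.
  rewrite (_ : N.*2.+3 = 2 * N.+1 + 1)%N; last by rewrite mulnS addn1 mul2n.
  by rewrite natrD natrM /y; nra.
exists [ffun i => Ordinal (yi i)] => i; rewrite /= in_itv/= ffunE/=.
exact: truncn_itv.
Qed.

Let node_near k t : cell k t -> enorm (vec t - node k) <= n.+1%:R / N.+1%:R.
Proof.
move=> kt; rewrite (le_trans (enorm_le_normr _))// ler_wpM2l//.
rewrite [leLHS]mx_normrE; apply: bigmax_le; first by rewrite invr_ge0.
move=> [i j] _ /=; rewrite (ord1 j) !mxE.
have := kt i; rewrite /= in_itv/= => /andP[k1 k2].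
have N0 : 0 < N.+1%:R :> R by rewrite ltr0n.
rewrite -(ler_pM2l N0) mulfV ?gt_eqF// -{1}(gtr0_norm N0) -normrM.
rewrite (_ : _ * _ = N.+1%:R * tnth t i + N.+1%:R - (k i)%:R).
  by rewrite ler_norml; move: k1 k2; rewrite -[(k i).+1]addn1 natrD => k1 k2;
    apply/andP; split; lra.
by field; rewrite gt_eqF.
Qed.

Let approx u (t : tup) : \bar R :=
  (\sum_k (`|dotv u (node k)|)%:E * (\1_(cell k) t)%:E)%E.

Let approxE u t k : cell k t -> approx u t = (`|dotv u (node k)|)%:E.
Proof.
move=> kt; rewrite /approx (bigD1 k)//= indicE mem_set//= mule1 big1 ?adde0//.
move=> l lk; rewrite indicE memNset/= ?mule0// => lt.
by move: lk; rewrite (cell_inj kt lt) eqxx.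
Qed.

Let mass k := fine (mu (cell k `&` B)).

Let approx_integral u :
  (\int[mu]_(t in B) approx u t = (\sum_k `|dotv u (mass k *: node k)|)%:E)%E.
Proof.
rewrite /approx ge0_integral_sum//.
- rewrite -sumEFin; apply: eq_bigr => k _.
  rewrite ge0_integralZl//.
  + rewrite integral_indic// dotvZr normrM EFinM muleC; congr (_ * _)%E.
    rewrite ger0_norm ?fine_ge0// fineK// ge0_fin_numE//.
    apply: (@le_lt_trans _ _ (mu B)); last by rewrite ltey_eq muB_fin.
    by apply: le_measure; rewrite ?inE//; exact: measurableI.
  + by apply/measurable_EFinP; exact: measurable_indic.
- by move=> k; apply: measurable_funeM; apply/measurable_EFinP; exact: measurable_indic.
Qed.

Let mapprox u : measurable_fun B (approx u).
Proof.
apply: emeasurable_sum => k.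
by apply: measurable_funeM; apply/measurable_EFinP; exact: measurable_indic.
Qed.

Let approx_ge0 u t : (0 <= approx u t)%E.
Proof. by apply: sume_ge0 => k _; rewrite mule_ge0// lee_fin. Qed.

Let err (u : 'cV[R]_n.+1) : R := enorm u * (n.+1%:R / N.+1%:R).

Let err_ge0 u : 0 <= err u.
Proof. by rewrite mulr_ge0 ?enorm_ge0// divr_ge0. Qed.

Let dotv_node u k t : cell k t -> `| dotv u (vec t) - dotv u (node k)| <= err u.
Proof.
move=> kt; rewrite -dotvBr (le_trans (dotv_le_enorm _ _))//.
by rewrite ler_wpM2l ?enorm_ge0// node_near.
Qed.

(** A Riemann sum of the moment is the support function of a zonotope: its generators are the cell
    corners weighted by the mass of the cell within the ball. The error is proportional to |u|,
    hence uniform over directions. *)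
Lemma ball_moment_discretization :
  exists s : seq 'cV[R]_n.+1, forall u,
    `|\sum_(w <- s) `|dotv u w| - fine (ball_moment u)| <=
    enorm u * (n.+1%:R / N.+1%:R) * fine (mu B).
Proof.
exists [seq mass k *: node k | k : {ffun 'I_n.+1 -> 'I_N.*2.+3}] => u.
rewrite big_image/=; set S := \sum_k _.
have Ffin : ball_moment u \is a fin_num.
  by rewrite ball_momentE fin_numM// ball_moment_axis_fin.
have bound (f g : tup -> \bar R) : measurable_fun B f -> measurable_fun B g ->
    (forall t, (0 <= f t)%E) -> (forall t, (0 <= g t)%E) ->
    (forall t, B t -> (f t <= g t + (err u)%:E)%E) ->
    (\int[mu]_(t in B) f t <= \int[mu]_(t in B) g t + (err u * fine (mu B))%:E)%E.
  move=> mf mg f0 g0 fg.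
  rewrite EFinM fineK// -integral_cst// -ge0_integralD//; last first.
    by move=> t _; rewrite lee_fin.
  apply: ge0_le_integral => //; first exact: emeasurable_funD.
have md := @measurable_dotv_tuple u B.
have h1 : (ball_moment u <= S%:E + (err u * fine (mu B))%:E)%E.
  rewrite -approx_integral; apply: bound => //.
  move=> t /cell_cover[k kt]; rewrite (approxE _ kt) -EFinD lee_fin.
  by rewrite -lerBlDl (le_trans (lerB_dist _ _))// dotv_node.
have h2 : (S%:E <= ball_moment u + (err u * fine (mu B))%:E)%E.
  rewrite -approx_integral; apply: bound => //.
  move=> t /cell_cover[k kt]; rewrite (approxE _ kt) -EFinD lee_fin.
  by rewrite -lerBlDl (le_trans (lerB_dist _ _))// distrC dotv_node.
move: h1 h2; rewrite -(fineK Ffin) -!EFinD !lee_fin => h1 h2.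
by rewrite -/(err u) ler_norml lerBlDl h2 andbT lerNl opprB lerBlDl h1.
Qed.

End discretization.

Lemma zonotope_approx_ball (eps : R) : 0 < eps ->
  exists s : seq 'cV[R]_n.+1, forall u,
    enorm u <= \sum_(w <- s) `|dotv u w| <= (1 + eps) * enorm u.
Proof.
move=> e0; pose c := fine (ball_moment axis).
have c0 : 0 < c by rewrite fine_gt0// ball_moment_axis_gt0/= ltey_eq
  ball_moment_axis_fin.
(* Chosen so that (1 + eta) / (1 - eta) = 1 + eps: the sums lie between (1 - eta) c |u| and (1 +
   eta) c |u|, and are divided by d = (1 - eta) c. *)
pose eta := eps / (2 + eps).
have eta0 : 0 < eta by rewrite divr_gt0//; lra.
have etaE : eta * (2 + eps) = eps by rewrite /eta divfK// gt_eqF//; lra.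
have eta1 : eta < 1 by rewrite ltr_pdivrMr; lra.
pose b := n.+1%:R * fine (mu B).
have b0 : 0 <= b by rewrite mulr_ge0// fine_ge0.
pose N := Num.truncn (b / (eta * c)).
have bN : b / N.+1%:R <= eta * c.
  have ec0 : 0 < eta * c by exact: mulr_gt0.
  rewrite ler_pdivrMr ?ltr0n// mulrC -ler_pdivrMr//.
  by rewrite ltW// truncnS_gt.
have [s sE] := @ball_moment_discretization N.
pose d := (1 - eta) * c; have d0 : 0 < d by rewrite mulr_gt0// subr_gt0.
exists (map ( *:%R d^-1) s) => u.
rewrite big_map (eq_bigr (fun w => d^-1 * `|dotv u w|)); last first.
  by move=> w _; rewrite dotvZr normrM gtr0_norm// invr_gt0.
rewrite -mulr_sumr mulrC ler_pdivlMr// ler_pdivrMr//.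
have u0 := enorm_ge0 u.
have FE : fine (ball_moment u) = enorm u * c.
  by rewrite ball_momentE fineM// ball_moment_axis_fin.
have := sE u; rewrite FE; set S := \sum_(w <- s) _.
have -> : enorm u * (n.+1%:R / N.+1%:R) * fine (mu B) = enorm u * (b / N.+1%:R).
  by rewrite /b; ring.
have := ler_wpM2l u0 bN; set r := enorm u * (b / _) => r1.
rewrite ler_norml => /andP[S1 S2].
have dE : (1 + eps) * d = (1 + eta) * c.
  by rewrite /d mulrA; congr (_ * _); lra.
apply/andP; split; first by rewrite /d; lra.
rewrite mulrAC dE; lra.
Qed.

End ball_zonotope.

(** * Steiner's formula *)

Section steiner.
Context (R : realType) (n : nat).
Local Notation vec := 'cV[R]_n.+1.

Definition parallel (A : set vec) (rho : R) : set vec :=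
  minkowski_sum A (dilate rho (@eball R n.+1)).

Lemma parallelP (A : set vec) rho x : 0 <= rho ->
  parallel A rho x <-> exists2 a, A a & enorm (x - a) <= rho.
Proof.
move=> r0; split=> [[y Ay [z /(eball_dilateP _ r0) ze <-]]|[y Ay xy]].
  by exists y => //; rewrite addrAC subrr add0r.
by exists y => //; exists (x - y); [exact/eball_dilateP|rewrite addrC subrK].
Qed.

Lemma parallel_compact (A : set vec) rho : 0 <= rho -> compact A -> compact (parallel A
  rho).
Proof.
move=> r0 cA.
rewrite (_ : parallel A rho =
    (fun p : vec * vec => p.1 + p.2) @` (A `*` [set x | enorm x <= rho])).
  apply: continuous_compact.
    by apply: continuous_subspaceT => p; apply: cvgD; [exact: cvg_fst|exact: cvg_snd].
  by apply: compact_setX => //; exact: enorm_ball_compact.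
apply/seteqP; split=> x /=.
  by move=> [a Aa [b /(eball_dilateP _ r0) br <-]]; exists (a, b).
by move=> [[a b] /= [Aa br] <-]; exists a => //; exists b => //; exact/eball_dilateP.
Qed.

(** In each segment the sign of <u, w> selects the endpoint that is extreme in direction [u]. *)
Lemma add_zonotope_reach rho s (A : set vec) u a : A a ->
  exists2 y, add_zonotope rho s A y &
    dotv u y = dotv u a + rho * \sum_(w <- s) `|dotv u w|.
Proof.
move=> Aa; elim: s => [|w s [y Zy yE]].
  by exists a => //; rewrite big_nil mulr0 addr0.
exists (y + Num.sg (dotv u w) *: (rho *: w)).
  exists y => //; exists (Num.sg (dotv u w)) => //.
  by rewrite /= in_itv/= -ler_norml normr_sg lern1 leq_b1.
by rewrite dotvDr !dotvZr yE big_cons mulrCA -normrEsg; ring.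
Qed.

(** One [a] serves all [u], so that [u] may later be taken to be [y - a] itself. *)
Lemma add_zonotope_near rho s (A : set vec) y : 0 <= rho -> add_zonotope rho s A y ->
  exists2 a, A a & forall u, dotv u (y - a) <= rho * \sum_(w <- s) `|dotv u w|.
Proof.
move=> r0; elim: s y => [|w s IH] y.
  by move=> Ay; exists y => // u; rewrite subrr dotv0r big_nil mulr0.
move=> [z /IH[a Aa az] [t]]; rewrite /= in_itv/= => t1 <-.
exists a => // u; rewrite addrAC dotvDr !dotvZr big_cons mulrDr [leRHS]addrC.
rewrite lerD ?az// mulrCA ler_wpM2l// (le_trans (ler_norm _))//.
by rewrite normrM ler_piMl// ler_norml.
Qed.

Lemma parallel_sub_zonotope rho s (A : set vec) : 0 <= rho -> compact A -> cvx A ->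
  (forall u, enorm u <= \sum_(w <- s) `|dotv u w|) ->
  parallel A rho `<=` add_zonotope rho s A.
Proof.
move=> r0 cA vA sE x /(parallelP _ _ r0)[a Aa xa].
apply: support_sub; [exact: add_zonotope_compact|exact: add_zonotope_cvx|move=> u].
have [y Zy yE] := add_zonotope_reach rho s u Aa.
exists y => //; rewrite yE -lerBlDl -dotvBr.
apply: le_trans (cauchy_schwarz _ _) _.
apply: (@le_trans _ _ (enorm u * rho)); first by rewrite ler_wpM2l ?enorm_ge0.
by rewrite mulrC ler_wpM2l.
Qed.

Lemma zonotope_sub_parallel rho s (A : set vec) k : 0 <= rho -> 0 <= k ->
  (forall u, \sum_(w <- s) `|dotv u w| <= k * enorm u) ->
  add_zonotope rho s A `<=` parallel A (k * rho).
Proof.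
move=> r0 k0 sE x /(add_zonotope_near r0)[a Aa ax].
apply/parallelP; first exact: mulr_ge0.
exists a => //; have [->|xa0] := eqVneq (enorm (x - a)) 0; first exact: mulr_ge0.
have xa : 0 < enorm (x - a) by rewrite lt_neqAle eq_sym xa0 enorm_ge0.
rewrite -(ler_pM2r xa) -expr2 -dotvv (le_trans (ax _))// [leRHS]mulrAC [leRHS]mulrC.
by rewrite ler_wpM2l.
Qed.

Definition parvol (A : set vec) (rho : R) : R := fine (volume (parallel A rho)).

Lemma parvolE (A : set vec) rho : 0 <= rho -> compact A ->
  volume (parallel A rho) = (parvol A rho)%:E.
Proof.
by move=> r0 cA; rewrite /parvol fineK// volume_fin_num//; exact: parallel_compact.
Qed.

(* The zonotope polynomial [P] squeezes [V = parvol A] between [V] and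
   [(1 + 1/(j+1))^(n+1) V]. *)
Lemma zonotope_coefficients : exists coef : nat -> set vec -> nat -> R,
  [/\ forall j A, compact A -> cvx A -> forall i, 0 <= coef j A i,
      forall j A B, compact A -> cvx A -> compact B -> cvx B -> A `<=` B ->
        forall i, coef j A i <= coef j B i &
      forall A rho, compact A -> cvx A -> 0 <= rho ->
        \sum_(i < n.+2) coef j A i * rho ^+ i @[j --> \oo] --> parvol A rho].
Proof.
have /choice[s sP] : forall j : nat, exists s : seq vec, forall u,
    enorm u <= \sum_(w <- s) `|dotv u w| <= (1 + j.+1%:R^-1) * enorm u.
  by move=> j; apply: zonotope_approx_ball; rewrite invr_gt0 ltr0n.
have /choice[coef cP] := fun j => zonotope_polynomial (s j).
exists coef; split.
- by move=> j; have [] := cP j.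
- by move=> j; have [] := cP j.
move=> A rho cA vA r0.
apply: (@squeeze_cvgr _ _ _ _ (cst (parvol A rho))
  (fun j => (1 + harmonic j) ^+ n.+1 * parvol A rho)); last 2 first.
- exact: cvg_cst.
- have h : (1 + harmonic j) ^+ n.+1 * parvol A rho @[j --> \oo] -->
      (1 + 0) ^+ n.+1 * parvol A rho.
    apply: cvgMr_tmp.
    apply: (cvg_comp (fun j : nat => 1 + harmonic j) (fun x : R => x ^+ n.+1));
      last exact: exprn_continuous.
    by apply: cvgD; [exact: cvg_cst|exact: cvg_harmonic].
  by rewrite addr0 expr1n mul1r in h.
near=> j.
have [c0 cle cE] := cP j;
  have k0 : 0 < 1 + harmonic j :> R by rewrite /harmonic/= addr_gt0.
have sE u : enorm u <= \sum_(w <- s j) `|dotv u w| by have /andP[] := sP j u.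
have sE' u : \sum_(w <- s j) `|dotv u w| <= (1 + harmonic j) * enorm u by have /andP[]
  := sP j u.
apply/andP; split.
  rewrite -lee_fin -parvolE// -cE//; apply: le_volume.
  - exact: parallel_compact.
  - exact: add_zonotope_compact.
  - exact: parallel_sub_zonotope.
(* At the reduced radius the zonotope sum fits into the parallel body of radius [rho]. Returning to
   [rho] costs at most (1 + 1/(j+1))^(n+1), as the coefficients are nonnegative and the degree is at
   most n+1. *)
have r0' : 0 <= rho / (1 + harmonic j) by rewrite divr_ge0// ltW.
have h : \sum_(i < n.+2) coef j A i * (rho / (1 + harmonic j)) ^+ i <= parvol A rho.
  rewrite -lee_fin -parvolE// -cE//.
  rewrite [X in parallel _ X](_ : _ = (1 + harmonic j) * (rho / (1 + harmonic j)));
    last first.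
    by rewrite mulrC divfK// gt_eqF.
  apply: le_volume.
  - exact: add_zonotope_compact.
  - by apply: parallel_compact => //; rewrite mulr_ge0// ltW.
  - by apply: zonotope_sub_parallel => //; exact: ltW.
rewrite -ler_pdivrMl ?exprn_gt0//; apply: le_trans h => /=.
rewrite mulr_sumr; apply: ler_sum => i _.
rewrite mulrCA ler_wpM2l ?c0// expr_div_n mulrC ler_wpM2l ?exprn_ge0//.
have k1 : 1 <= 1 + harmonic j :> R by rewrite lerDl /harmonic/= invr_ge0.
rewrite lef_pV2 ?posrE ?exprn_gt0//; apply: ler_weXn2l => //.
by rewrite -ltnS.
Unshelve. all: by end_near. Qed.

(** Interpolation at the nodes 0, ..., n+1, by inverting their Vandermonde matrix. *)
Lemma coefficients_from_values : exists m : 'M[R]_n.+2,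
  forall (c : nat -> R) (i : 'I_n.+2),
    c i = \sum_(k < n.+2) m i k * \sum_(j < n.+2) c j * k%:R ^+ j.
Proof.
pose a : 'rV[R]_n.+2 := \row_k k%:R.
pose V := Vandermonde n.+2 a.
have VU : V \in unitmx.
  rewrite unitmxE det_Vandermonde unitfE; apply/prodf_neq0 => i _.
  apply/prodf_neq0 => j ij; rewrite !mxE subr_eq0 eqr_nat.
  by rewrite gtn_eqF.
exists (invmx V)^T => c i.
pose r : 'rV[R]_n.+2 := \row_j c j.
have : r = (r *m V) *m invmx V by rewrite mulmxK.
move=> /rowP/(_ i); rewrite !mxE => ->; apply: eq_bigr => k _.
rewrite [X in X * _]mxE [in RHS]mxE mulrC; congr (_ * _).
by apply: eq_bigr => j _; rewrite !mxE.
Qed.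

Definition values_to_coef : 'M[R]_n.+2 := xget 0 [set m : 'M[R]_n.+2 |
  forall (c : nat -> R) (i : 'I_n.+2),
    c i = \sum_(k < n.+2) m i k * \sum_(j < n.+2) c j * k%:R ^+ j].

Lemma values_to_coefE (c : nat -> R) (i : 'I_n.+2) :
  c i = \sum_(k < n.+2) values_to_coef i k * \sum_(j < n.+2) c j * k%:R ^+ j.
Proof.
rewrite /values_to_coef; case: xgetP => [m _ /= -> //|h].
by have [m mP] := coefficients_from_values; case: (h m).
Qed.

(** Interpolating the parallel volumes at integer radii defines the coefficients before the volume
    is known to be polynomial in the radius. *)
Definition steiner_coef (A : set vec) (i : 'I_n.+2) : R :=
  \sum_(k < n.+2) values_to_coef i k * parvol A k%:R.

Lemma steiner_coef_uniq (A : set vec) (c : nat -> R) :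
  (forall rho, 0 <= rho -> parvol A rho = \sum_(j < n.+2) c j * rho ^+ j) ->
  forall i : 'I_n.+2, c i = steiner_coef A i.
Proof.
by move=> cE i; rewrite values_to_coefE; apply: eq_bigr => k _; rewrite cE.
Qed.

Lemma cvg_sum_ord (m : nat) (f : 'I_m -> nat -> R) (l : 'I_m -> R) :
  (forall i, f i j @[j --> \oo] --> l i) ->
  \sum_(i < m) f i j @[j --> \oo] --> \sum_(i < m) l i.
Proof.
by move=> fl; apply: cvg_big => //; exact: add_continuous.
Qed.

(** [steiner_coef A i] is the limit of the zonotope coefficients, because both come from values by
    the same matrix. All three properties pass to the limit. *)
Lemma steiner_coef_theory :
  [/\ forall A, compact A -> cvx A -> forall i, 0 <= steiner_coef A i,
      forall A B, compact A -> cvx A -> compact B -> cvx B -> A `<=` B ->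
        forall i, steiner_coef A i <= steiner_coef B i &
      forall A rho, compact A -> cvx A -> 0 <= rho ->
        parvol A rho = \sum_(i < n.+2) steiner_coef A i * rho ^+ i].
Proof.
have [coef [c0 cle cE]] := zonotope_coefficients.
have coefC A (i : 'I_n.+2) : compact A -> cvx A ->
    coef j A i @[j --> \oo] --> steiner_coef A i.
  move=> cA vA; under eq_fun do rewrite values_to_coefE.
  by apply: cvg_sum_ord => k; apply: cvgMl_tmp; apply: cE.
split.
- move=> A cA vA i; apply: (ler_cvg_to (@cvg_cst _ 0 _ _ _) (coefC A i cA vA)).
  by near=> j; exact: c0.
- move=> A B cA vA cB vB AB i.
  apply: (ler_cvg_to (coefC A i cA vA) (coefC B i cB vB)).
  by near=> j; exact: cle.
- move=> A rho cA vA r0.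
  have h : \sum_(i < n.+2) coef j A i * rho ^+ i @[j --> \oo] -->
      \sum_(i < n.+2) steiner_coef A i * rho ^+ i.
    by apply: cvg_sum_ord => i; apply: cvgMr_tmp; exact: coefC.
  by apply: (cvg_unique _ (cE A rho cA vA r0) h); exact: norm_hausdorff.
Unshelve. all: by end_near. Qed.

End steiner.

Section convexity.
Context (R : realType).

Lemma convex_setE m (A : set 'cV[R]_m) : convex_set A <-> cvx A.
Proof.
split=> [cA x y t t01 Ax Ay|vA x y t /set_mem Ax /set_mem Ay].
  have := cA x y (Itv01 (proj1 (andP t01)) (proj2 (andP t01))) (mem_set Ax) (mem_set
    Ay).
  by move/set_mem.
apply/mem_set/vA => //; exact/andP.
Qed.

Lemma body_cvx m (K : convex_body R m) : cvx K.
Proof. exact/convex_setE/body_convex. Qed.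

End convexity.

(** * Monotonicity and homogeneity of the quermassintegrals *)

Section quermassintegrals.
Context (R : realType) (n : nat).
Local Notation vec := 'cV[R]_n.+1.

Lemma volume_homothety (A : set vec) (a : R) (v : vec) : 0 < a -> compact A ->
  volume [set a *: x + v | x in A] = ((a ^+ n.+1)%:E * volume A)%E.
Proof.
move=> a0 cA.
have aU : (a%:M : 'M[R]_n.+1) \in unitmx by rewrite unitmxE det_scalar unitfE
  expf_neq0// gt_eqF.
have := volume_affine v aU cA; rewrite det_scalar normrX gtr0_norm// => <-.
by congr volume; apply: eq_imagel => x _; rewrite mul_scalar_mx.
Qed.

Lemma homothety_compact (A : set vec) (a : R) (v : vec) : compact A ->
  compact [set a *: x + v | x in A].
Proof.
move=> cA; rewrite (_ : [set _ | _ in _] = [set a%:M *m x + v | x in A]).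
  exact: affine_image_compact.
by apply: eq_imagel => x _; rewrite mul_scalar_mx.
Qed.

Lemma homothety_cvx (A : set vec) (a : R) (v : vec) : cvx A ->
  cvx [set a *: x + v | x in A].
Proof.
move=> vA _ _ t t01 [x Ax <-] [y Ay <-].
exists (t *: x + (1 - t) *: y); first exact: vA.
by apply/matrixP => i j; rewrite !mxE; ring.
Qed.

(** Because (aA + v) + rho B = a (A + (rho/a) B) + v. *)
Lemma parvol_homothety (A : set vec) (a : R) (v : vec) rho :
  0 < a -> 0 <= rho -> compact A ->
  parvol [set a *: x + v | x in A] rho = a ^+ n.+1 * parvol A (rho / a).
Proof.
move=> a0 r0 cA; have ra0 : 0 <= rho / a by rewrite divr_ge0// ltW.
apply: EFin_inj; rewrite -parvolE//; last exact: homothety_compact.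
rewrite EFinM -parvolE// -(volume_homothety v a0); last exact: parallel_compact.
congr volume; apply/seteqP; split=> x /=.
  move=> /(parallelP _ _ r0)[_ [y Ay <-] xy].
  exists (a^-1 *: (x - v)); last by rewrite scalerA divff ?gt_eqF// scale1r subrK.
  apply/parallelP => //; exists y => //.
  rewrite ler_pdivlMr// mulrC -[X in X * _](gtr0_norm a0) -enormZ scalerBr scalerA.
  by rewrite divff ?gt_eqF// scale1r -addrA -opprD addrC addrC [v + _]addrC.
move=> [y /(parallelP _ _ ra0)[z Az yz] <-]; apply/parallelP => //.
exists (a *: z + v); first by exists z.
rewrite opprD addrACA subrr addr0 -scalerBr enormZ gtr0_norm//.
by rewrite mulrC -ler_pdivlMr.
Qed.

Lemma steiner_coef_homothety (A : set vec) (a : R) (v : vec) (i : 'I_n.+2) :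
  0 < a -> compact A -> cvx A ->
  steiner_coef [set a *: x + v | x in A] i = a ^+ (n.+1 - i) * steiner_coef A i.
Proof.
move=> a0 cA vA.
pose c (j : nat) : R := a ^+ (n.+1 - j) * steiner_coef A (inord j).
rewrite -(@steiner_coef_uniq _ _ _ c).
  by rewrite /c inord_val.
move=> rho r0; rewrite parvol_homothety//.
have [_ _ ->//] := steiner_coef_theory R n; last by rewrite divr_ge0// ltW.
rewrite mulr_sumr; apply: eq_bigr => j _; rewrite /c inord_val.
have jn : (j <= n.+1)%N by rewrite -ltnS.
rewrite -{1}(subnK jn) exprD expr_div_n.
by field; rewrite expf_neq0// gt_eqF.
Qed.

(** Any solution selected by [xget] is identified by uniqueness, and the default value is excluded
    by the solution built from [steiner_coef]. *)
Lemma quermassintegralE (K : convex_body R n.+1) (i : 'I_n.+2) :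
  quermassintegral i K = steiner_coef K i / 'C(n.+1, i)%:R.
Proof.
have C0 (j : 'I_n.+2) : 'C(n.+1, j)%:R != 0 :> R.
  by rewrite pnatr_eq0 -lt0n bin_gt0 -ltnS.
have [_ _ stE] := steiner_coef_theory R n.
have cK := @body_compact _ _ K; have vK := @body_cvx _ _ K.
rewrite /quermassintegral; case: xgetP => [w _ /= wK|h].
  rewrite -(@steiner_coef_uniq _ _ _ (fun j => 'C(n.+1, j)%:R * w (inord j))).
    by rewrite inord_val mulrC mulKf.
  move=> rho r0; apply: EFin_inj; rewrite -parvolE// [LHS]wK//.
  by congr EFin; apply: eq_bigr => j _; rewrite inord_val.
case: (h [ffun j => steiner_coef K j / 'C(n.+1, j)%:R]) => rho r0.
rewrite [LHS]parvolE// stE//; congr EFin; apply: eq_bigr => j _.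
by rewrite ffunE [in RHS]mulrCA divff ?C0// mulr1.
Qed.

Lemma quermassintegral_le_homothety (K L : convex_body R n.+1) (a : R) (v : vec)
    (i : 'I_n.+2) : 0 < a -> (forall x, body K x -> body L (a *: x + v)) ->
  quermassintegral i K <= a^-1 ^+ (n.+1 - i) * quermassintegral i L.
Proof.
move=> a0 KL; rewrite !quermassintegralE mulrA ler_wpM2r ?invr_ge0//.
rewrite exprVn ler_pdivlMl ?exprn_gt0//.
have cK := @body_compact _ _ K; have vK := @body_cvx _ _ K.
rewrite -(steiner_coef_homothety v)//.
have [_ le_st _] := steiner_coef_theory R n; apply: le_st => //.
- exact: homothety_compact.
- exact: homothety_cvx.
- exact: body_compact.
- exact: body_cvx.
by move=> _ [x Kx <-]; exact: KL.
Qed.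

End quermassintegrals.

(** * Bounded asymmetry of convex bodies *)

Section asymmetry.
Context (R : realType) (n : nat).
Implicit Types (L : set 'cV[R]_n) (x y : 'cV[R]_n).

(** Unnormalized weights keep the tail of a combination in the form that the induction needs. *)
Lemma cvx_comb L m (w : 'I_m -> R) (X : 'I_m -> 'cV[R]_n) : cvx L ->
  (forall i, 0 <= w i) -> (forall i, L (X i)) -> 0 < \sum_i w i ->
  L ((\sum_i w i)^-1 *: \sum_i w i *: X i).
Proof.
move=> vL; elim: m w X => [|m IH] w X w0 LX; first by rewrite big_ord0 ltxx.
rewrite !big_ord_recl => s0.
have s'0 : 0 <= \sum_(i < m) w (lift ord0 i) by apply: sumr_ge0.
have [sE|sN] := eqVneq (\sum_(i < m) w (lift ord0 i)) 0.
  have w'0 i : w (lift ord0 i) = 0.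
    move/eqP: sE; rewrite psumr_eq0// => /allP/(_ i).
    by rewrite mem_index_enum => /(_ isT)/eqP.
  move: s0; rewrite sE addr0 => s0.
  rewrite [X in _ + X]big1; last by move=> i _; rewrite w'0 scale0r.
  by rewrite addr0 scalerA mulVf ?scale1r// gt_eqF.
have sp : 0 < \sum_(i < m) w (lift ord0 i) by rewrite lt_neqAle eq_sym sN.
have := IH (fun i => w (lift ord0 i)) (fun i => X (lift ord0 i)) (fun i => w0 _) (fun i
  => LX _) sp.
set S := \sum_(i < m) w _ in s0 s'0 sN sp *; set Y := \sum_(i < m) _ *: _ => LY.
have t01 : 0 <= w ord0 / (w ord0 + S) <= 1.
  by apply/andP; split; [rewrite divr_ge0// ltW|rewrite ler_pdivrMr// mul1r lerDl].
have := vL _ _ _ t01 (LX ord0) LY; congr (L _).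
rewrite scalerDr !scalerA; congr (_ *: _ + _ *: _); first by rewrite mulrC.
by field; rewrite sN gt_eqF.
Qed.

(** Homogeneous coordinates: affine independence becomes linear independence, and barycentric
    coordinates become coefficients of a linear combination. *)
Definition affine_row x : 'rV[R]_(n + 1) := row_mx x^T 1%:M.

Definition affine_rows m (X : 'I_m -> 'cV[R]_n) : 'M[R]_(m, n + 1) :=
  \matrix_i affine_row (X i).

Lemma affine_row_comb m (l : 'rV[R]_m) (X : 'I_m -> 'cV[R]_n) x :
  affine_row x = l *m affine_rows X ->
  x = \sum_i l 0 i *: X i /\ \sum_i l 0 i = 1.
Proof.
rewrite mulmx_sum_row => /rowP e; split.
  apply/matrixP => k j; rewrite (ord1 j) summxE.
  have := e (lshift 1 k); rewrite row_mxEl mxE summxE => ->.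
  by apply: eq_bigr => i _;
    rewrite mxE [row _ _ _ _]mxE [affine_rows _ _ _]mxE row_mxEl !mxE.
have := e (rshift n 0); rewrite row_mxEr mxE eqxx mulr1n summxE => ->.
by apply: eq_bigr => i _;
  rewrite mxE [row _ _ _ _]mxE [affine_rows _ _ _]mxE row_mxEr mxE eqxx mulr1.
Qed.

(** A maximal affinely independent family in [L] spans its affine hull, since any point outside the
    span could be appended. *)
Lemma maximal_affine_rows L : L !=set0 ->
  exists m (X : 'I_m -> 'cV[R]_n),
    [/\ (m <= n.+1)%N, forall i, L (X i), row_free (affine_rows X) &
      forall x, L x -> (affine_row x <= affine_rows X)%MS].
Proof.
move=> [x0 Lx0].
pose P m := `[< exists X : 'I_m -> 'cV[R]_n,
  (forall i, L (X i)) /\ row_free (affine_rows X) >].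
have P0 : exists m, P m.
  exists 0%N; apply/asboolP; exists (fun=> x0); split; first by move=> [].
  by rewrite /row_free -leqn0 rank_leq_row.
have Pn m : P m -> (m <= n.+1)%N.
  by move=> /asboolP[X [_ /eqP <-]]; rewrite -[X in (_ <= X)%N]addn1 rank_leq_col.
have [m /asboolP[X [LX Xfree]] mmax] := ex_maxnP P0 Pn.
exists m, X; split => //; first by apply: Pn; apply/asboolP; exists X.
move=> x Lx; apply: contraT => xX; exfalso.
suff : P (m + 1)%N by move=> /mmax; rewrite addn1 ltnn.
apply/asboolP.
exists (fun i => match fintype.split i with inl j => X j | inr _ => x end).
split; first by move=> i; case: fintype.split.
have -> : affine_rows (fun i : 'I_(m + 1) => match fintype.split i with inl j => X j |
  inr _ => x end)
    = col_mx (affine_rows X) (affine_row x).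
  apply/matrixP => i k; rewrite mxE [RHS]mxE.
  by case: fintype.split => j; rewrite ?(ord1 j)// [RHS]mxE.
apply: inj_row_free => u; rewrite -[u]hsubmxK mul_row_col => u0.
have [b0|b0] := eqVneq (rsubmx u 0 0) 0.
  move: u0; rewrite [rsubmx u]mx11_scalar b0 mul_scalar_mx scale0r addr0 => /eqP.
  rewrite mulmx_free_eq0// => /eqP ->.
  by rewrite raddf0 row_mx0.
case/negP: xX.
have -> : affine_row x = - (rsubmx u 0 0)^-1 *: (lsubmx u *m affine_rows X).
  move: u0; rewrite [rsubmx u in X in _ + X]mx11_scalar mul_scalar_mx => /eqP.
  rewrite addr_eq0 => /eqP ->.
  by rewrite scaleNr scalerN opprK scalerA mulVf// scale1r.
by apply: scalemx_sub; exact: submxMl.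
Qed.

(** The numerators in Cramer's rule. *)
Lemma det_replace_row m (C : 'M[R]_m) (v : 'rV[R]_m) i :
  \det (\matrix_j (if j == i then v else row j C)) = (v *m \adj C) 0 i.
Proof.
rewrite (expand_det_row _ i) mxE; apply: eq_bigr => j _.
rewrite !mxE eqxx; congr (_ * _).
rewrite /cofactor; congr (_ * \det _).
apply/matrixP => k l; rewrite !mxE [_ == i]eq_sym (negbTE (neq_lift _ _)).
by rewrite mxE.
Qed.

Lemma det_bound m (b : R) : exists B : R, forall C : 'M[R]_m,
  (forall i j, `|C i j| <= b) -> `|\det C| <= B.
Proof.
exists (\sum_(s : {perm 'I_m}) \prod_(i < m) b) => C Cb.
rewrite (le_trans (ler_norm_sum _ _ _))//; apply: ler_sum => s _.
rewrite normrM normrX normrN1 expr1n mul1r normr_prod.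
by apply: ler_prod => i _; rewrite normr_ge0 Cb.
Qed.

(* Choose points of [L] spanning its affine hull whose determinant is at least
   half of the supremum: by Cramer's rule, the barycentric coordinates of any
   point of [L] in this frame are at most 2, so the point reflection through
   the centroid of the frame maps [L] into a fixed dilate of [L]. *)
Lemma bounded_asymmetry L (M : R) : L !=set0 -> cvx L ->
  (forall x, L x -> enorm x <= M) ->
  exists2 c, L c & forall x, L x -> L (c - (2 * n.+1%:R)^-1 *: (x - c)).
Proof.
move=> L0 vL LM.
have [m [X0 [mn LX0 X0free X0max]]] := maximal_affine_rows L0.
(* Expressing points in the fixed frame [X0] gives square matrices [C X], and so determinants, even
   when [L] is lower-dimensional. *)
pose A0 := affine_rows X0; pose Q := pinvmx A0.
pose C (X : 'I_m -> 'cV[R]_n) := affine_rows X *m Q.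
have xQ x : L x -> affine_row x *m Q *m A0 = affine_row x.
  by move=> Lx; rewrite mulmxKpV// X0max.
have CX X : (forall i, L (X i)) -> C X *m A0 = affine_rows X.
  move=> LX; apply/row_matrixP => i.
  by rewrite row_mul [row i (C X)]row_mul !rowK xQ.
pose b := \sum_k \sum_j (`|M| + 1) * `|Q k j|.
have Cb X : (forall i, L (X i)) -> forall i j, `|C X i j| <= b.
  move=> LX i j; rewrite mxE (le_trans (ler_norm_sum _ _ _))//.
  apply: ler_sum => k _; rewrite normrM.
  apply: (@le_trans _ _ ((`|M| + 1) * `|Q k j|)).
    rewrite ler_wpM2r// mxE -(splitK k); case: fintype.split => l /=.
      rewrite row_mxEl mxE (le_trans (coord_le_enorm _ _))// (le_trans (LM _ (LX i)))//.
      by rewrite (le_trans (ler_norm _))// lerDl.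
    by rewrite row_mxEr (ord1 l) mxE eqxx normr1 lerDr.
  rewrite (bigD1 j)//= lerDl; apply: sumr_ge0 => l _.
  by rewrite mulr_ge0// addr_ge0.
have [B CB] := det_bound m b.
pose S := [set d : R | exists2 X, (forall i, L (X i)) & d = `|\det (C X)|].
(* The frame [X0] has determinant 1 relative to itself, so the supremum is positive and a
   near-maximal frame is nondegenerate. *)
have S1 : S 1.
  exists X0 => //; rewrite (_ : C X0 = 1%:M) ?det1 ?normr1//.
  exact: mulmxVp.
have supS : has_sup S.
  split; first by exists 1.
  by exists B => _ [X LX ->]; apply: CB; exact: Cb.
have sup1 : 1 <= sup S by apply: ub_le_sup => //; exact: (proj2 supS).
have s2 : 0 < sup S / 2 by rewrite divr_gt0// (lt_le_trans ltr01).
have [_ [X LX ->] Xsup] := sup_adherent s2 supS.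
have dC : sup S < 2 * `|\det (C X)| by lra.
have Cmax Y : (forall i, L (Y i)) -> `|\det (C Y)| <= 2 * `|\det (C X)|.
  move=> LY; rewrite (le_trans _ (ltW dC))//; apply: ub_le_sup;
    first exact: (proj2 supS).
  by exists Y.
have d0 : 0 < `|\det (C X)| by lra.
have CU : C X \in unitmx by rewrite unitmxE unitfE -normr_gt0.
have coords x : L x -> exists l : 'rV[R]_m,
    [/\ x = \sum_i l 0 i *: X i, \sum_i l 0 i = 1 & forall i, l 0 i <= 2].
  move=> Lx; exists (affine_row x *m Q *m invmx (C X)).
  have e : affine_row x = affine_row x *m Q *m invmx (C X) *m affine_rows X.
    by rewrite -(CX X)// mulmxA mulmxKV// xQ.
  have [e1 e2] := affine_row_comb e; split => // i.
  rewrite (le_trans (ler_norm _))//.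
  rewrite /invmx CU -scalemxAr mxE normrM -det_replace_row.
  rewrite normfV ler_pdivrMl// mulrC.
  pose Y j := if j == i then x else X j.
  have LY j : L (Y j) by rewrite /Y; case: ifP.
  apply: le_trans (Cmax Y LY); rewrite le_eqVlt; apply/orP; left; apply/eqP.
  congr (`|\det _|); apply/row_matrixP => j; rewrite rowK [RHS]row_mul rowK /Y.
  by case: ifP => // _; rewrite row_mul rowK.
have m0 : 0 < m%:R :> R.
  rewrite ltr0n lt0n; apply/eqP => m0; have [x Lx] := L0.
  have [l [_ + _]] := coords x Lx; move: l; rewrite m0 => l.
  by rewrite big_ord0 => /eqP; rewrite eq_sym oner_eq0.
have mC : m%:R != 0 :> R by rewrite gt_eqF.
pose c := m%:R^-1 *: \sum_i X i.
(* The reflected point (1 + t) c - t x has barycentric coordinates (1 + t)/m - t l_i. Since l_i <=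
   2, they are nonnegative once 2t <= 1/m, and m <= n+1. *)
pose t : R := (2 * n.+1%:R)^-1.
have t0 : 0 < t by rewrite invr_gt0 mulr_gt0.
have t2 : 2 * t <= m%:R^-1.
  rewrite /t invfM mulrA divff// mul1r lef_pV2 ?posrE ?ltr0n//;
    first by rewrite ler_nat.
  by rewrite -(ltr_nat R).
have comb (w : 'I_m -> R) : (forall i, 0 <= w i) -> \sum_i w i = 1 ->
    L (\sum_i w i *: X i).
  move=> w0 w1; have := cvx_comb vL w0 LX.
  by rewrite w1 invr1 scale1r; apply.
exists c.
  rewrite /c scaler_sumr; apply: comb => [i|]; first by rewrite invr_ge0.
  by rewrite sumr_const card_ord -[RHS](mulVf mC) mulr_natr.
move=> x Lx; have [l [xE l1 l2]] := coords x Lx; rewrite -/t.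
rewrite (_ : _ - _ = \sum_i ((1 + t) / m%:R - t * l 0 i) *: X i).
  apply: comb => [i|].
    have : t * l 0 i <= 2 * t by rewrite mulrC ler_wpM2r// ltW.
    have : 0 <= t / m%:R by rewrite divr_ge0// ltW.
    by rewrite mulrDl mul1r; lra.
  rewrite sumrB -[X in _ - X]mulr_sumr l1 sumr_const card_ord -[_ *+ m]mulr_natr
    divfK//; lra.
under eq_bigr do rewrite scalerBl -[t * _ *: _]scalerA -[(1 + t) / _ *: _]scalerA.
rewrite sumrB -!scaler_sumr -xE -/c.
by rewrite scalerDl scale1r scalerBr opprB addrA.
Qed.

End asymmetry.

(** * Covariant operators *)

Section covariant_operators.
Context (R : realType) (n : nat).
Implicit Types (K L : convex_body R n) (u : 'cV[R]_n).

Lemma body_bounded K : exists2 M : R, 0 < M & forall x, body K x -> enorm x <= M.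
Proof.
have cK := @body_compact _ _ K.
have ce : {within (body K), continuous (@enorm R n)}.
  by apply: continuous_subspaceT; exact: enorm_continuous.
have [c /set_mem Kc cmax] := compact_EVT_max (@body_neq0 _ _ K) cK ce.
exists (enorm c + 1); first by rewrite ltr_wpDl ?enorm_ge0.
by move=> x Kx; rewrite (le_trans (cmax _ (mem_set Kx)))// lerDl.
Qed.

Lemma hausdorff_dist_linear_image (g h : 'M[R]_n) K e : 0 <= e ->
  (forall x, body K x -> enorm (g *m x - h *m x) <= e) ->
  hausdorff_dist (linear_image g K) (linear_image h K) <= e.
Proof.
move=> e0 gh; apply: ge_inf; first by exists 0 => d [].
split=> //= _ [x Kx <-].
  exists (h *m x); first by exists x.
  exists (g *m x - h *m x); last by rewrite addrC subrK.
  by apply/eball_dilateP => //; exact: gh.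
exists (g *m x); first by exists x.
exists (h *m x - g *m x); last by rewrite addrC subrK.
by apply/eball_dilateP => //; rewrite -enormN opprB; exact: gh.
Qed.

(** Among the n+1 candidates e/2, ..., e/(n+2), one is not a root of the characteristic polynomial,
    which has degree n. *)
Lemma unitmx_perturbation (p : 'M[R]_n) (e : R) : 0 < e ->
  exists2 a : R, 0 < a < e & p - a%:M \in unitmx.
Proof.
move=> e0; pose s := [seq e / i.+2%:R | i <- iota 0 n.+1].
have sU : uniq s.
  rewrite map_inj_uniq ?iota_uniq// => i j /(mulfI (lt0r_neq0 e0))/invr_inj/eqP.
  by rewrite eqr_nat => /eqP[].
have [sroot|/allPn[a]] := boolP (all (root (char_poly p)) s).
  have := max_poly_roots (monic_neq0 (char_poly_monic p)) sroot sU.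
  by rewrite size_char_poly size_map size_iota ltnn.
move=> /mapP[i _ ->] nroot; exists (e / i.+2%:R).
  by rewrite divr_gt0//= ltr_pdivrMr// ltr_pMr// ltr1n.
move: nroot; rewrite -eigenvalue_root_char /eigenvalue negbK /eigenspace kermx_eq0.
by rewrite row_free_unit.
Qed.

Lemma covariant_linear_image (D : convex_body R n -> convex_body R n) :
  continuous D -> GL_covariant D ->
  forall (g : 'M[R]_n) K, D (linear_image g K) = linear_image g (D K).
Proof.
move=> cD covD g K; apply: (@mdist_positivity R (convex_body R n)).
apply/eqP; rewrite eq_le mdist_ge0 andbT; apply/ler_addgt0Pr => e e0; rewrite add0r.
have e2 : 0 < e / 2 by rewrite divr_gt0.
have := cD (linear_image g K) _ (nbhsx_ballx _ _ e2).
rewrite nbhs_filterE/= => /nbhs_ballP[d /= d0 dD].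
have [M M0 KM] := body_bounded K; have [N N0 DN] := body_bounded (D K).
(* The first bound keeps the perturbed image of [K] within the modulus of continuity [d]; the second
   moves the image of [D K] by at most e/2. *)
have m0 : 0 < Order.min (d / 2 / M) (e / 2 / N).
  by rewrite lt_min !divr_gt0.
have [a /andP[a0]] := unitmx_perturbation g m0.
rewrite lt_min !ltr_pdivlMr// => /andP[aM aN] gU.
have diff (L : convex_body R n) (B : R) : (forall x, body L x -> enorm x <= B) ->
    forall x, body L x -> enorm (g *m x - (g - a%:M) *m x) <= a * B.
  move=> LB x Lx; rewrite mulmxBl opprB addrC subrK mul_scalar_mx enormZ gtr0_norm//.
  by rewrite ler_wpM2l ?LB// ltW.
have h1 : ball (linear_image g K) d (linear_image (g - a%:M) K).
  rewrite ballEmdist/=; apply: (@le_lt_trans _ _ (a * M)); last by lra.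
  by apply: hausdorff_dist_linear_image; [rewrite mulr_ge0// ltW|exact: diff].
have := dD _ h1; rewrite /= ballEmdist/= (covD (g - a%:M))// => h2.
apply: (le_trans (metric_triangle _ (linear_image (g - a%:M) (D K)) _)).
rewrite [leRHS]splitr; apply: lerD; first exact: ltW h2.
rewrite metric_sym; apply: (@le_trans _ _ (a * N)); last by rewrite ler_pdivlMr// ltW.
by apply: hausdorff_dist_linear_image; [rewrite mulr_ge0// ltW|exact: diff].
Qed.

End covariant_operators.

(** * Segments and the simplex as test bodies *)

Section body_construction.
Context (R : realType) (n : nat).

(** A symmetric segment placed at the midpoint, so that compactness and convexity come from
    [add_segment]. *)
Definition segment_set (p q : 'cV[R]_n) : set 'cV[R]_n :=
  add_segment (2^-1 *: (q - p)) [set 2^-1 *: (p + q)].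

Lemma segment_setP (p q x : 'cV[R]_n) :
  segment_set p q x <-> exists2 t, 0 <= t <= 1 & x = (1 - t) *: p + t *: q.
Proof.
split=> [[_ -> [t]]|[t /andP[t0 t1] ->]].
  rewrite /= in_itv/= => /andP[t1 t2] <-; exists ((t + 1) / 2).
    by apply/andP; split; lra.
  by apply/matrixP => i j; rewrite !mxE; field.
exists (2^-1 *: (p + q)) => //; exists (2 * t - 1).
  by rewrite /= in_itv/=; apply/andP; split; lra.
by apply/matrixP => i j; rewrite !mxE; field.
Qed.

Lemma segment_set_neq0 p q : segment_set p q !=set0.
Proof.
exists p; apply/segment_setP; exists 0; first by rewrite lexx ler01.
by rewrite subr0 scale1r scale0r addr0.
Qed.

Lemma segment_set_compact p q : compact (segment_set p q).
Proof. by apply: add_segment_compact; exact: compact_set1. Qed.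

Lemma segment_set_convex p q : convex_set (segment_set p q).
Proof.
apply/convex_setE/add_segment_cvx => _ _ t _ -> ->.
by rewrite -scalerDl [t + _]addrC subrK scale1r.
Qed.

Definition segment_body (p q : 'cV[R]_n) : convex_body R n :=
  ConvexBody (segment_set_neq0 p q) (segment_set_compact (p := p) (q := q))
    (segment_set_convex (p := p) (q := q)).

Definition simplex_set : set 'cV[R]_n :=
  [set x | (forall i, 0 <= x i 0) /\ \sum_i x i 0 <= 1].

Lemma simplex_set_neq0 : simplex_set !=set0.
Proof. by exists 0; split=> [i|]; rewrite ?mxE// big1// => i _; rewrite mxE. Qed.

Lemma simplex_coord_le1 x i : simplex_set x -> x i 0 <= 1.
Proof.
move=> [x0 x1]; apply: le_trans x1; rewrite (bigD1 i)//= lerDl.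
by apply: sumr_ge0 => j _.
Qed.

Lemma simplex_set_compact : compact simplex_set.
Proof.
apply: (@closed_enorm_bounded_compact _ _ _ n%:R); last first.
  move=> x sx; apply: (le_trans (enorm_le_normr x)); apply: ler_piMr => //.
  rewrite [leLHS]mx_normrE; apply: bigmax_le => // -[i j] _ /=; rewrite (ord1 j).
  by rewrite ger0_norm ?simplex_coord_le1//; case: sx.
rewrite (_ : simplex_set = (\bigcap_(i in [set: 'I_n])
    ((fun x : 'cV[R]_n => x i 0) @^-1` [set y | 0 <= y])) `&`
    (dotv (const_mx 1) @^-1` [set y | y <= 1])).
  apply: closedI.
    apply: closed_bigI => i _; apply: closed_comp; last exact: closed_ge.
    by move=> x _; exact: coord_continuous.
  apply: closed_comp; last exact: closed_le.
  by move=> x _; exact: dotv_continuous.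
have dE x : dotv (const_mx 1) x = \sum_i x i 0.
  by apply: eq_bigr => i _; rewrite mxE mul1r.
apply/seteqP; split=> x /=; rewrite dE.
  by move=> [x0 x1]; split => // i _; exact: x0.
by move=> [x0 x1]; split => // i; exact: x0.
Qed.

Lemma simplex_set_convex : convex_set simplex_set.
Proof.
apply/convex_setE => x y t /andP[t0 t1] [x0 x1] [y0 y1]; split=> [i|].
  by rewrite !mxE addr_ge0// mulr_ge0// subr_ge0.
rewrite (eq_bigr (fun i => t * x i 0 + (1 - t) * y i 0)); last first.
  by move=> i _; rewrite !mxE.
rewrite big_split/= -!mulr_sumr.
have t1' : 0 <= 1 - t by rewrite subr_ge0.
have := ler_wpM2l t0 x1; have := ler_wpM2l t1' y1; lra.
Qed.

Definition simplex : convex_body R n :=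
  ConvexBody simplex_set_neq0 simplex_set_compact simplex_set_convex.

End body_construction.

(** * Structure of a continuous covariant operator *)

Section covariant_structure.
Context (R : realType) (n : nat).
Context (D : convex_body R n.+2 -> convex_body R n.+2).
Context (D_continuous : continuous D) (D_covariant : GL_covariant D).
Local Notation vec := 'cV[R]_n.+2.
Local Notation e0 := (delta_mx 0 0 : vec).
Local Notation e1 := (delta_mx 1 0 : vec).
Local Notation M := (D (segment_body e0 e1)).
Implicit Types (K : convex_body R n.+2) (u x y z : vec).

(** In terms of the support function h of [K]: a = -h(-u) and b = h(u). *)
Definition is_range K u (a b : R) :=
  [/\ forall x, body K x -> a <= dotv u x <= b,
      exists2 x, body K x & dotv u x = a &
      exists2 x, body K x & dotv u x = b].

Lemma ex_range K u : exists a b, is_range K u a b.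
Proof.
have cK := @body_compact _ _ K.
have cu : {within (body K), continuous (dotv u)}.
  by apply: continuous_subspaceT; exact: dotv_continuous.
have [p /set_mem Kp pmin] := compact_EVT_min (@body_neq0 _ _ K) cK cu.
have [q /set_mem Kq qmax] := compact_EVT_max (@body_neq0 _ _ K) cK cu.
exists (dotv u p), (dotv u q); split; [|by exists p|by exists q].
by move=> x /mem_set Kx; rewrite pmin ?qmax.
Qed.

Lemma is_rangeN K u a b : is_range K u a b -> is_range K (- u) (- b) (- a).
Proof.
move=> [h [p Kp pa] [q Kq qb]]; split.
- by move=> x /h; rewrite dotvNl !lerN2 andbC.
- by exists q; rewrite // dotvNl qb.
- by exists p; rewrite // dotvNl pa.
Qed.

Lemma delta_mul (u x : vec) (i : 'I_n.+2) :
  ((delta_mx i 0 : vec) *m u^T) *m x = dotv u x *: (delta_mx i 0 : vec).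
Proof. by rewrite -mulmxA [u^T *m x]mx11_scalar mul_mx_scalar dotvE. Qed.

(* Projecting [K] to a line along [u] yields the image of the segment
   [e0, e1] under the linear map sending e0, e1 to the endpoints. *)
Lemma covariant_range K u a b : is_range K u a b ->
  [set dotv u z | z in body (D K)] =
  [set a * m 0 0 + b * m 1 0 | m in body M].
Proof.
move=> [ab [p Kp pa] [q Kq qb]].
(* Both matrices are singular, which is why covariance was extended beyond GL(n). *)
pose g : 'M[R]_n.+2 := e0 *m u^T; pose h : 'M[R]_n.+2 := e0 *m (a *: e0 + b *: e1)^T.
have hE x : dotv (a *: e0 + b *: e1) x = a * x 0 0 + b * x 1 0.
  by rewrite dotvC dotvDr !dotvZr !(dotvC x) !dotv_delta.
have h01 t : h *m ((1 - t) *: e0 + t *: e1) = ((1 - t) * a + t * b) *: e0.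
  rewrite delta_mul hE !mxE !eqxx /=; congr (_ *: _); ring.
have gh : linear_image g K = linear_image h (segment_body e0 e1).
  apply: body_inj; apply/seteqP; split=> _ [x Kx <-].
    have [t t01 xt] : exists2 t, 0 <= t <= 1 & dotv u x = (1 - t) * a + t * b.
      have /andP[ax xb] := ab _ Kx; have [bE|ba] := eqVneq a b.
        exists 0; first by rewrite lexx ler01.
        by rewrite subr0 mul1r mul0r addr0; apply/eqP; rewrite eq_le ax bE xb.
      have d0 : 0 < b - a by rewrite subr_gt0 lt_neqAle ba (le_trans ax xb).
      exists ((dotv u x - a) / (b - a)); last by field; rewrite gt_eqF.
      apply/andP; split; first by rewrite divr_ge0 ?(ltW d0)// subr_ge0.
      by rewrite ler_pdivrMr// mul1r lerD2r.
    exists ((1 - t) *: e0 + t *: e1); last by rewrite h01 delta_mul xt.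
    by apply/segment_setP; exists t.
  move/segment_setP: Kx => [t t01 ->]; exists ((1 - t) *: p + t *: q).
    have := @body_cvx _ _ K q p t t01 Kq Kp.
    by rewrite addrC.
  by rewrite h01 delta_mul dotvDr !dotvZr pa qb.
have Dgh : linear_image g (D K) = linear_image h M.
  rewrite -(covariant_linear_image D_continuous D_covariant) gh.
  exact: covariant_linear_image.
have e00 (s : R) : (s *: e0) 0 0 = s by rewrite !mxE !eqxx mulr1.
apply/seteqP; split=> _ [x Dx <-].
  have : body (linear_image g (D K)) (g *m x) by exists x.
  rewrite Dgh => -[m Mm]; rewrite !delta_mul hE => /matrixP/(_ 0 0).
  by rewrite !e00 => <-; exists m.
have : body (linear_image h M) (h *m x) by exists x.
rewrite -Dgh => -[z Dz]; rewrite !delta_mul hE => /matrixP/(_ 0 0).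
by rewrite !e00 => <-; exists z.
Qed.

(** If [M] is diagonal, a range [a, b] of [K] becomes (a + b) [X] for [D K]. On the simplex,
    [e0 - e1] has range [-1, 1], so z_0 = z_1 for points z of the image; [e0] and [e0 + e1] both
    have range [0, 1], so [X] contains 2t with t. Being bounded, [X] is {0}. *)
Lemma diagonal_trivial : (forall m, body M m -> m 0 0 = m 1 0) -> trivial_operator D.
Proof.
move=> Mdiag.
pose T := simplex R n.+2; pose X := [set m 1 0 | m in body M].
have T0 : simplex_set (0 : vec).
  by split=> [i|]; rewrite ?mxE// big1// => i _; rewrite mxE.
have Te i : simplex_set (delta_mx i 0 : vec).
  split=> [j|]; first by rewrite mxE; case: (_ && _).
  rewrite (bigD1 i)//= big1 ?mxE ?eqxx ?addr0// => j ji.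
  by rewrite mxE (negbTE ji).
have sum2 x : simplex_set x -> x 0 0 + x 1 0 <= 1.
  move=> [x0 x1]; apply: le_trans x1.
  rewrite (bigD1 0)//= (bigD1 1)//= addrA lerDl.
  by apply: sumr_ge0 => j _.
have r0 : is_range T e0 0 1.
  split; first by move=> x Tx; rewrite dotv_delta (proj1 Tx) simplex_coord_le1.
    by exists 0 => //; rewrite dotv0r.
  by exists e0; [exact: Te|rewrite dotv_delta mxE].
have rs : is_range T (e0 + e1) 0 1.
  have dE x : dotv (e0 + e1) x = x 0 0 + x 1 0.
    by rewrite dotvC dotvDr !(dotvC x) !dotv_delta.
  split; first by move=> x Tx; rewrite dE sum2// andbT addr_ge0// (proj1 Tx).
    by exists 0 => //; rewrite dotv0r.
  by exists e0; [exact: Te|rewrite dE !mxE/= addr0].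
have rd : is_range T (e0 - e1) (-1) 1.
  have dE x : dotv (e0 - e1) x = x 0 0 - x 1 0 by rewrite dotvBl !dotv_delta.
  split.
  - move=> x Tx; rewrite dE; have := simplex_coord_le1 0 Tx;
    have := simplex_coord_le1 1 Tx.
    by have := (proj1 Tx) 0; have := (proj1 Tx) 1; move=> *; apply/andP; split; lra.
  - by exists e1; [exact: Te|rewrite dE !mxE/= sub0r].
  - by exists e0; [exact: Te|rewrite dE !mxE/= subr0].
have DT z : body (D T) z -> z 0 0 = z 1 0.
  move=> Dz; have : [set dotv (e0 - e1) z | z in body (D T)] (z 0 0 - z 1 0).
    by exists z => //; rewrite dotvBl !dotv_delta.
  rewrite (covariant_range rd) => -[m Mm] /=; rewrite (Mdiag _ Mm) => h.
  by apply/eqP; rewrite -subr_eq0 -h; apply/eqP; ring.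
have X2 t : X t -> X (2 * t).
  move=> [m Mm <-].
  have : [set 0 * m 0 0 + 1 * m 1 0 | m in body M] (m 1 0).
    by exists m => //; rewrite mul0r mul1r add0r.
  rewrite -(covariant_range r0) => -[z Dz]; rewrite dotv_delta => zm.
  have : [set dotv (e0 + e1) z | z in body (D T)] (2 * m 1 0).
    exists z => //; rewrite dotvC dotvDr !(dotvC z) !dotv_delta -(DT _ Dz) zm; ring.
  rewrite (covariant_range rs) => -[m' Mm'] /=; rewrite mul0r mul1r add0r => <-.
  by exists m'.
have M10 m : body M m -> m 1 0 = 0.
  move=> Mm; have [B B0 MB] := body_bounded M.
  have Xk k : X (2 ^+ k * m 1 0).
    elim: k => [|k IH]; first by rewrite expr0 mul1r; exists m.
    by rewrite exprS -mulrA; exact: X2.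
  apply/eqP; apply: contraT => m0.
  have m1 : 0 < `|m 1 0| by rewrite normr_gt0.
  have kB k : k%:R * `|m 1 0| <= B.
    have [m' Mm' m'E] := Xk k.
    apply: (le_trans _ (MB _ Mm')); apply: le_trans (coord_le_enorm _ 1).
    rewrite m'E normrM ler_wpM2r// ger0_norm ?exprn_ge0// -natrX ler_nat.
    by rewrite ltnW// ltn_expl.
  have := kB (Num.truncn (B / `|m 1 0|)).+1; rewrite -ler_pdivlMr// leNgt.
  by rewrite truncnS_gt.
move=> K; apply/seteqP; split=> [z Dz|_ ->].
  apply/eqP; rewrite -normr_le0 (le_trans (normr_le_enorm z))//.
  (* Taking the point [z] itself as the direction gives <z, z> = 0. *)
  have [a [b ab]] := ex_range K z.
  have : [set dotv z y | y in body (D K)] (dotv z z) by exists z.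
  rewrite (covariant_range ab) => -[m Mm].
  rewrite (Mdiag _ Mm) (M10 _ Mm) !mulr0 addr0 dotvv => /esym/eqP.
  by rewrite sqrf_eq0 => /eqP ->.
have [z Dz] := @body_neq0 _ _ (D K).
suff -> : 0 = z by [].
apply/esym/eqP; rewrite -normr_le0 (le_trans (normr_le_enorm z))//.
have [a [b ab]] := ex_range K z.
have : [set dotv z y | y in body (D K)] (dotv z z) by exists z.
rewrite (covariant_range ab) => -[m Mm].
rewrite (Mdiag _ Mm) (M10 _ Mm) !mulr0 addr0 dotvv => /esym/eqP.
by rewrite sqrf_eq0 => /eqP ->.
Qed.

(** The same [m] used for the ranges [a, b] of [u] and [-b, -a] of [- u] yields two points of [D K]
    whose products with [u] differ by (b - a)(m_1 - m_0), up to order. *)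
Lemma covariant_width m K u x x' : body M m -> body K x -> body K x' ->
  exists y y', [/\ body (D K) y, body (D K) y' &
    `|m 0 0 - m 1 0| * dotv u (x - x') <= dotv u y - dotv u y'].
Proof.
move=> Mm Kx Kx'; have [a [b ab]] := ex_range K u.
have : [set a * m 0 0 + b * m 1 0 | m in body M] (a * m 0 0 + b * m 1 0) by exists m.
rewrite -(covariant_range ab) => -[y Dy yE].
have : [set - b * m 0 0 + - a * m 1 0 | m in body M] (- b * m 0 0 + - a * m 1 0) by
  exists m.
rewrite -(covariant_range (is_rangeN ab)) => -[y' Dy' y'E].
have w : dotv u (x - x') <= b - a.
  by case: ab => ab _ _; have /andP[_ h1] := ab _ Kx; have /andP[h2 _] := ab _ Kx';
    rewrite dotvBr lerB.
rewrite dotvNl in y'E.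
have [mm|mm] := leP (m 0 0) (m 1 0).
  exists y, y'; split => //; rewrite ler0_norm ?subr_le0//.
  apply: (@le_trans _ _ (- (m 0 0 - m 1 0) * (b - a))); last by rewrite yE; nra.
  by rewrite ler_wpM2l// oppr_ge0 subr_le0.
exists y', y; split => //; rewrite gtr0_norm ?subr_gt0//.
apply: (@le_trans _ _ ((m 0 0 - m 1 0) * (b - a))); last by rewrite yE; nra.
by rewrite ler_wpM2l// subr_ge0 ltW.
Qed.

Lemma covariant_contains_homothet m : body M m -> m 0 0 != m 1 0 ->
  exists2 s : R, 0 < s & forall K, exists v : vec,
    forall x, body K x -> body (D K) (s *: x + v).
Proof.
(* [t] is the constant of [bounded_asymmetry] in dimension n+2. *)
move=> Mm m01; pose t : R := (2 * n.+3%:R)^-1; pose d := `|m 0 0 - m 1 0|.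
have t0 : 0 < t by rewrite invr_gt0 mulr_gt0.
have d0 : 0 < d by rewrite normr_gt0 subr_eq0.
exists (t / (1 + t) * d); first by rewrite mulr_gt0// divr_gt0// addr_gt0.
move=> K; set s := t / (1 + t) * d.
have [B _ DB] := body_bounded (D K).
have [c Dc cP] := bounded_asymmetry (@body_neq0 _ _ (D K)) (@body_cvx _ _ (D K)) DB.
have [x0 Kx0] := @body_neq0 _ _ K.
(* The homothety sends the arbitrary base point [x0] to [c], so its image of [x] is c + s (x - x0),
   and [covariant_width] applies to [x] and [x0]. *)
exists (c - s *: x0) => x Kx.
apply: support_sub; [exact: body_compact|exact: body_cvx|move=> u].
have [y [y' [Dy Dy' yy']]] := covariant_width u Mm Kx Kx0.
have t01 : 0 <= (1 + t)^-1 <= 1.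
  by rewrite invr_ge0 invf_le1 ?lerDl ?addr_ge0 ?addr_gt0// ltW.
(* Mixing the reflection of [y'] with [y] in the ratio 1 : t gives c + t/(1+t) (y - y'), which
   explains the factor t/(1+t) in [s]. *)
have := @body_cvx _ _ (D K) _ _ _ t01 (cP _ Dy') Dy.
set z := _ + _ => Dz; exists z => //.
have t1 : 1 + t != 0 by rewrite gt_eqF// addr_gt0.
have -> : dotv u z = dotv u c + t / (1 + t) * (dotv u y - dotv u y').
  rewrite /z dotvDr !dotvZr dotvBr dotvZr dotvBr -/t; field.
  exact: t1.
rewrite addrCA -scalerBr dotvDr dotvZr lerD2l /s -mulrA ler_wpM2l//.
by rewrite divr_ge0// ?addr_ge0// ltW.
Qed.

End covariant_structure.

Theorem theorem4p3 (R : realType) (n : nat) (hn : (2 <= n)%N)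
    (D : convex_body R n -> convex_body R n)
    (D_nontrivial : ~ trivial_operator D)
    (D_continuous : continuous D)
    (D_covariant : GL_covariant D) :
  forall i : 'I_n.+1, (i < n)%N ->
    exists2 c : R, 0 < c &
      forall K : convex_body R n,
        quermassintegral i K <= c * quermassintegral i (D K).
Proof.
case: n hn D D_nontrivial D_continuous D_covariant => [|[|n]]// _ D Dnt Dc Dcov i _.
have [m Mm m01] : exists2 m, body (D (segment_body (delta_mx 0 0) (delta_mx 1 0))) m &
    m 0 0 != m 1 0.
  apply: contra_notP Dnt => h; apply: diagonal_trivial => // m Mm.
  by apply/eqP; apply: contra_notT h => m01; exists m.
have [s s0 sP] := covariant_contains_homothet Dc Dcov Mm m01.
exists (s^-1 ^+ (n.+2 - i)); first by rewrite exprn_gt0// invr_gt0.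
move=> K; have [v vP] := sP K.
exact: quermassintegral_le_homothety vP.
Qed.
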